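(* There exist universal constants $C_2,C_3>0$ such that the following holds. Let $n\in\mathbb N$, $M>0$ and let $\{\varepsilon_{I\times J}: I\times J\in\mathscr R_n\}$ be a given set of positive scalars. Then there exists $N=N(n,M,\{\varepsilon_{I\times J}\})\in\mathbb N$ such that for every linear operator $T: H^1_N(\delta^2)\to H^1_N(\delta^2)$ with $\|T\|\le M$ there exist (pairwise) disjoint collections $\mathscr E_{I\times J}$, indexed by $I\times J\in\mathscr R_n$, each consisting of pairwise disjoint dyadic rectangles, such that the functions $$b_{I\times J}=\sum_{K\times L\in\mathscr E_{I\times J}}h_{K\times L}$$ satisfy the following conditions. (i) $\mathscr E_{I\times J}\subset\mathscr R_N$ and $|b_{I\times J}|\le 1$ for all $I\times J\in\mathscr R_n$. (ii) The orthogonal projection $$Q(f)=\sum_{I\times J\in\mathscr R_n}\Big\langle f,\frac{b_{I\times J}}{\|b_{I\times J}\|_2}\Big\rangle\frac{b_{I\times J}}{\|b_{I\times J}\|_2}$$ is a bounded operator on $H^1(\delta^2)$ with $Q(H^1(\delta^2))=\mathrm{span}\{b_{I\times J}: I\times J\in\mathscr R_n\}$ and $\|Q: H^1(\delta^2)\to H^1(\delta^2)\|\le C_2$. (iii) The map $S: H^1_n(\delta^2)\to\mathrm{span}\{b_{I\times J}: I\times J\in\mathscr R_n\}\cap H^1_N(\delta^2)$ defined as the linear extension of $h_{I\times J}\mapsto b_{I\times J}$ is an isomorphism with $\|S\|\,\|S^{-1}\|\le C_3$. (iv) For all $I\times J\in\mathscr R_n$, $$\sum_{K\times L\in\mathscr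 R_n,\ K\times L\ne I\times J}|\langle Tb_{K\times L},b_{I\times J}\rangle|\le\varepsilon_{I\times J}\,\|b_{I\times J}\|_2^2 .$$
   Context: Dyadic intervals: $\mathscr D=\{[2^{-j}k,2^{-j}(k+1)) : j,k\in\mathbb N_0,\ k\le 2^j-1\}$. Dyadic rectangles: $\mathscr R=\mathscr D\times\mathscr D$, and for $n\in\mathbb N$, $\mathscr R_n=\{I\times J\in\mathscr R: |I|\ge 2^{-n},\ |J|\ge 2^{-n}\}$. For $I\in\mathscr D$ the $L^\infty$-normalized Haar function $h_I$ is $+1$ on the left half of $I$, $-1$ on the right half of $I$, and $0$ elsewhere; $h_{I\times J}(s,t)=h_I(s)h_J(t)$. Scalars are real. The space $H^1(\delta^2)$ is the completion of $\mathrm{span}\{h_{I\times J}: I\times J\in\mathscr R\}$ under the norm $$\Big\|\sum a_{I\times J}h_{I\times J}\Big\|_{H^1(\delta^2)}=\int_0^1\!\int_0^1\Big(\sum a_{I\times J}^2h_{I\times J}^2(s,t)\Big)^{1/2}ds\,dt ,$$ and $H^1_n(\delta^2)=\mathrm{span}\{h_{I\times J}: I\times J\in\mathscr R_n\}$ equipped with the norm of $H^1(\delta^2)$. The bracket is $\langle f,g\rangle=\int_0^1\int_0^1 fg\,ds\,dt$ on finite Haar sums (extended by continuity in $f\in H^1(\delta^2)$ when $g$ is a finite Haar sum), and $\|\cdot\|_2$ is the $L^2([0,1]^2)$ norm. *)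

(* Defs.v *)
From mathcomp Require Import all_boot all_order all_algebra.
From mathcomp Require Import all_classical all_reals all_analysis.

Set Implicit Arguments.
Unset Strict Implicit.
Unset Printing Implicit Defensive.

Import Order.TTheory GRing.Theory Num.Theory.
Import numFieldNormedType.Exports.

Local Open Scope classical_set_scope.
Local Open Scope ring_scope.

(* The pair (j, k) with k < 2 ^ j encodes [2^-j k, 2^-j (k + 1)); distinct
   pairs give distinct intervals. *)
Definition dyadic : Type := {j : nat & 'I_(2 ^ j)%N}.

Definition rect : Type := (dyadic * dyadic)%type.

Section Haar.
Context {R : realType}.
Implicit Types (I : dyadic) (r : rect) (f g : R * R -> R).

Definition dlen I : R := 2 ^- tag I.
Definition dleft I : R := (tagged I : 'I_(2 ^ tag I))%:R * dlen I.
Definition dmid I : R := dleft I + dlen I / 2.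
Definition dright I : R := dleft I + dlen I.

Definition rset r : set (R * R) :=
  `[dleft r.1, dright r.1[ `*` `[dleft r.2, dright r.2[.

Definition haar1 I (x : R) : R :=
  \1_(`[dleft I, dmid I[ : set R) x - \1_(`[dmid I, dright I[ : set R) x.

Definition haar r : R * R -> R := fun p => haar1 r.1 p.1 * haar1 r.2 p.2.

Definition int2 f : R :=
  \int[lebesgue_measure]_(t in `[0, 1])
    (\int[lebesgue_measure]_(s in `[0, 1]) f (s, t)).

Definition bracket f g : R := int2 (fun p => f p * g p).
Definition norm2 f : R := Num.sqrt (int2 (fun p => f p ^+ 2)).

Definition lspan {V : lmodType R} (A : set V) : set V :=
  [set v | exists (m : nat) (a : 'I_m -> R) (w : 'I_m -> V),
     (forall i, A (w i)) /\ v = \sum_(i < m) a i *: w i].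

Definition rects_le (n : nat) : set rect :=
  [set r | (2 ^- n : R) <= dlen r.1 /\ (2 ^- n : R) <= dlen r.2].

Definition haar_span : set (R * R -> R) := lspan (range haar).

Definition H1n (n : nat) : set (R * R -> R) := lspan (haar @` rects_le n).

(* Meaningful on [haar_span] only; there the value does not depend on the
   representation, the Haar functions being linearly independent. *)
Definition H1norm f : R :=
  xget 0 [set x | exists (A : set rect) (a : rect -> R),
    [/\ finite_set A,
        f = \sum_(r \in A) a r *: haar r &
        x = int2 (fun p => Num.sqrt (\sum_(r \in A) a r ^+ 2 * haar r p ^+ 2))]].

Definition linear_on {V W : lmodType R} (D : set V) (T : V -> W) : Prop :=
  forall (a : R) (u v : V), D u -> D v -> T (a *: u + v) = a *: T u + T v.

Definition opnorm {V W : Type} (nV : V -> R) (nW : W -> R) (D : set V)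
    (T : V -> W) : \bar R :=
  ereal_sup [set (nW (T x))%:E | x in [set x | D x /\ nV x <= 1]].

(* [iota : haar_span -> H] exhibits H as the completion H^1(delta^2); its values
   outside [haar_span] are irrelevant. *)
Definition is_completion (H : completeNormedModType R)
    (iota : (R * R -> R) -> H) : Prop :=
  [/\ linear_on haar_span iota,
      (forall f, haar_span f -> `|iota f| = H1norm f) &
      dense (iota @` haar_span)].

(* <., g> extended by continuity along iota : the limit of <u, g> as
   iota u -> f with u in haar_span *)
Definition bracket_ext (H : completeNormedModType R)
    (iota : (R * R -> R) -> H) (f : H) g : R :=
  lim ((fun u => bracket u g) @
       filter_from (nbhs f) (fun B => haar_span `&` iota @^-1` B)).

(* b is indexed by all rectangles, but only its restriction to [rects_le n]
   matters. *)
Definition Qproj (H : completeNormedModType R) (iota : (R * R -> R) -> H)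
    (n : nat) (b : rect -> R * R -> R) (f : H) : H :=
  \sum_(r \in rects_le n)
    bracket_ext iota f ((norm2 (b r))^-1 *: b r) *:
      iota ((norm2 (b r))^-1 *: b r).

Definition haar_block (E : set rect) : R * R -> R := \sum_(k \in E) haar k.

End Haar.

Arguments rects_le R n : clear implicits.
Arguments rset R r : clear implicits.

(* Main.v *)
Require Import Defs.
From mathcomp Require Import all_boot all_order all_algebra.
From mathcomp Require Import all_classical all_reals all_analysis.
From mathcomp Require Import measurable_realfun.
From mathcomp Require Import ring lra zify.

Set Implicit Arguments.
Unset Strict Implicit.
Unset Printing Implicit Defensive.

Import Order.TTheory GRing.Theory Num.Theory.
Import numFieldNormedType.Exports.

Local Open Scope classical_set_scope.
Local Open Scope ring_scope.

(** Each block spreads out only the first factor of a Haar function. For a rectangle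
    r = I x J, with |I| = $2^{-i}$, the block function $b_r$ is the sum of the
    $h_{K x J}$ over the dyadic K of one length $2^{-m(r)}$ that lie in a set $A_I$:
    the points whose binary digits at the positions W, 2W, .., iW are those of the
    index of I. The frequency m(r) may be any number in the window [iW, (i+1)W), which
    lies after the digits that define $A_I$ and before the next selected digit. The
    windows make the blocks disjoint, for every choice of the frequencies.

    The map that reads off the selected digits preserves Lebesgue measure
    (digits_uniform) and pulls I back to $A_I$. As $b_r^2$ is the indicator of
    $A_I$ x J, the square function of a combination of the $b_r$ is that of the same
    combination of the $h_r$ composed with this map. Hence $h_r \mapsto b_r$ is an
    isometry (H1norm_blocks), and $C_3 = 1$.

    The coefficient of f at $b_r$ is the mean over $A_I$ x J of a function that depends
    only on the first m(r) digits of the first variable. The digits selected after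
    these are independent of them (digits_equidistributed), so this mean is equal to
    the mean over any fibre of the digit map inside $A_I$. Thus the coefficients of all
    the blocks come from one conditional expectation, and convexity of the Euclidean
    norm bounds the square function of Qf by the conditional expectation of that of f
    (H1norm_blockcoef); so $C_2 = 1$. The interlacing of frequencies and selected
    digits is essential here: with $A_I = I$ and high frequencies the averages would be taken
    over different partitions, and the bound would grow with n.

    It remains to choose the frequencies. At a fixed r, the W candidates
    $b_r^{(m)}$ have disjoint Haar spectra and the square function of any combination
    with signs is at most $\sqrt W$. So the sums over m of $|<f, b_r^{(m)}>|$ and of
    $|<T b_r^{(m)}, g>|$, for a given f and a given block g, are at most
    $\sqrt W$ times the norm of f, resp. of T, and for W large one of the candidates
    has small interactions with all the blocks that have been chosen before
    (select_freqs).

    All the integrals are finite sums: functions are evaluated on grids of mesh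
    $2^{-G}$, where the point of index k lies in the dyadic interval of length $2^{-i}$
    and index k / $2^{G-i}$ (integer quotient). *)

(** * Integrals of step functions on a dyadic grid *)

Lemma integrable_setU d (T : measurableType d) (R : realType)
    (mu : {measure set T -> \bar R}) (A B : set T) (f : T -> \bar R) :
  measurable A -> measurable B -> [disjoint A & B] ->
  mu.-integrable A f -> mu.-integrable B f -> mu.-integrable (A `|` B) f.
Proof.
move=> mA mB AB /integrableP[mfA iA] /integrableP[mfB iB].
have mf : measurable_fun (A `|` B) f by exact/measurable_funU.
apply/integrableP; split => //.
rewrite ge0_integral_setU//; first exact: lte_add_pinfty.
exact: measurableT_comp.
Qed.

(** Induction on the number of cells: on each cell the integrand is a constant. *)
Lemma Rintegral_step (R : realType) (f : R -> R) (h : R) (n : nat) : 0 < h ->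
  (forall (k : nat) x, (k < n)%N ->
    k%:R * h <= x < k.+1%:R * h -> f x = f (k%:R * h)) ->
  lebesgue_measure.-integrable `[0, n%:R * h[ (EFin \o f) /\
  \int[lebesgue_measure]_(x in `[0, n%:R * h[) f x = h * \sum_(k < n) f (k%:R * h).
Proof.
move=> h0; elim: n => [|n IH] fE.
  rewrite mul0r set_itvco0 big_ord0 mulr0 Rintegral_set0; split=> //.
  exact: integrable_set0.
have [|iI eI] := IH; first by move=> k x kn; apply: fE; exact: ltnW.
have splitE : `[0, n.+1%:R * h[%classic = `[0, n%:R * h[ `|` `[n%:R * h, n.+1%:R * h[.
  rewrite -itv_bndbnd_setU// bnd_simp; first by rewrite mulr_ge0// ltW.
  by rewrite ler_pM2r// ler_nat.
have cstE x : x \in (`[n%:R * h, n.+1%:R * h[%classic : set R) -> f x = f (n%:R * h).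
  by rewrite inE/= in_itv/= => xI; apply: fE.
have muE : lebesgue_measure (`[n%:R * h, n.+1%:R * h[%classic : set R) = h%:E.
  rewrite lebesgue_measure_itv/= lte_fin ltr_pM2r// ltr_nat ltnSn -EFinB.
  by congr EFin; rewrite -mulrBl -natrB// subSnn mul1r.
have iJ : lebesgue_measure.-integrable `[n%:R * h, n.+1%:R * h[ (EFin \o f).
  apply: (@eq_integrable _ _ _ _ _ _ (EFin \o cst (f (n%:R * h)))) => //.
    by move=> x xI /=; rewrite (cstE _ xI).
  apply: measurable_bounded_integrable => //=.
  - by rewrite muE ltry.
  - by apply: bounded_cst.
have dIJ : [disjoint `[0%R, n%:R * h[%classic & `[n%:R * h, n.+1%:R * h[%classic].
  apply/disj_setPS => x [/=]; rewrite !in_itv/= => /andP[_ a] /andP[b _].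
  by move: (lt_le_trans a b); rewrite ltxx.
have iU : lebesgue_measure.-integrable `[0, n.+1%:R * h[ (EFin \o f).
  by rewrite splitE; apply: integrable_setU.
split=> //.
rewrite [in LHS]splitE Rintegral_setU//; last by rewrite -splitE.
rewrite eI big_ord_recr mulrDr; congr (_ + _).
transitivity (\int[lebesgue_measure]_(x in `[(n%:R * h)%R, (n.+1%:R * h)%R[)
    cst (f (n%:R * h)) x).
  by apply: eq_Rintegral => x xI; exact: cstE.
rewrite Rintegral_cst//= mulrC; congr (_ * _).
by rewrite [X in fine X]muE.
Qed.

Section grid.
Variable R : realType.

Definition grid_pt (G k : nat) : R := k%:R / 2 ^+ G.

Definition incell (G k : nat) (x : R) := grid_pt G k <= x < grid_pt G k.+1.

(** Cells are half-open, and nothing is asked outside $[0,1)^2$: the part of the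
    closed square that is left out is negligible for the iterated integral. *)
Definition gridfun (G : nat) (f : R * R -> R) := forall k l x y,
  (k < 2 ^ G)%N -> (l < 2 ^ G)%N -> incell G k x -> incell G l y ->
  f (x, y) = f (grid_pt G k, grid_pt G l).

Lemma incell_pt G k : incell G k (grid_pt G k).
Proof. by rewrite /incell lexx ltr_pM2r ?invr_gt0 ?exprn_gt0// ltr_nat ltnSn. Qed.

Lemma Rintegral_grid (G : nat) (f : R -> R) :
  (forall k x, (k < 2 ^ G)%N -> incell G k x -> f x = f (grid_pt G k)) ->
  \int[lebesgue_measure]_(x in `[0, 1]) f x = 2 ^- G * \sum_(k < 2 ^ G) f (grid_pt G k).
Proof.
move=> fE; have h0 : 0 < 2 ^- G :> R by rewrite invr_gt0 exprn_gt0.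
have [k x kG xk|iI eI] := @Rintegral_step R f (2 ^- G) (2 ^ G) h0; first exact: fE.
have e1 : (2 ^ G)%N%:R * 2 ^- G = 1 :> R by rewrite natrX divff// expf_neq0.
rewrite e1 in iI eI.
by rewrite -eI -Rintegral_itv_bndo_bndc.
Qed.

Definition grid_mean G (F : nat -> nat -> R) : R :=
  2 ^- G * \sum_(l < 2 ^ G) (2 ^- G * \sum_(k < 2 ^ G) F k l).

Lemma int2_grid (G : nat) (f : R * R -> R) : gridfun G f ->
  int2 f = grid_mean G (fun k l => f (grid_pt G k, grid_pt G l)).
Proof.
move=> fE; rewrite /int2 (@Rintegral_grid G); last first.
  move=> l y lG yl; rewrite !(@Rintegral_grid G).
  - by congr (_ * _); apply: eq_bigr => k _; rewrite !(fE k l)//; exact: incell_pt.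
  - by move=> k x kG xk; rewrite (fE k l)//; exact: incell_pt.
  - by move=> k x kG xk; rewrite [LHS](fE k l)// [RHS](fE k l)//; exact: incell_pt.
congr (_ * _); apply: eq_bigr => l _; rewrite (@Rintegral_grid G)//.
by move=> k x kG xk; rewrite (fE k l)//; exact: incell_pt.
Qed.

End grid.

(** * Sums over binary expansions *)

Lemma sum_ord_mul (V : nmodType) (a d : nat) (F : nat -> V) :
  \sum_(k < a * d) F k = \sum_(u < a) \sum_(v < d) F (u * d + v)%N.
Proof.
elim: a => [|a IH]; first by rewrite mul0n !big_ord0.
rewrite big_ord_recr /= -IH mulSnr.
rewrite -!(big_mkord xpredT) (big_cat_nat _ (n := a * d))//= ?leq_addr//.
congr (_ + _); rewrite -{1}[(a * d)%N]add0n big_addn addKn.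
by rewrite big_mkord; apply: eq_bigr => v _; rewrite addnC.
Qed.

Lemma sum_pow2_div (V : nmodType) (G d : nat) (F : nat -> V) : (d <= G)%N ->
  \sum_(k < 2 ^ G) F (k %/ 2 ^ d)%N = \sum_(u < 2 ^ (G - d)) F u *+ 2 ^ d.
Proof.
move=> dG; have -> : (2 ^ G = 2 ^ (G - d) * 2 ^ d)%N by rewrite -expnD subnK.
rewrite (sum_ord_mul _ _ (fun k => F (k %/ 2 ^ d)%N)).
apply: eq_bigr => u _; rewrite -[in RHS](card_ord (2 ^ d)) -sumr_const.
by apply: eq_bigr => v _; rewrite divnMDl ?expn_gt0// divn_small// addn0.
Qed.

Lemma sum_delta (R : nzRingType) n (a : nat) (F : nat -> R) : (a < n)%N ->
  \sum_(k < n) (k == a :> nat)%:R * F k = F a.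
Proof.
move=> an; rewrite (bigD1 (Ordinal an))//= eqxx mul1r big1 ?addr0// => i /negP ia.
by case: eqP => [e|]; rewrite ?mul0r//; case: ia; apply/eqP/val_inj.
Qed.

Lemma divn_pow2 (k a b : nat) : (k %/ 2 ^ a %/ 2 ^ b)%N = (k %/ 2 ^ (a + b))%N.
Proof. by rewrite -divnMA -expnD. Qed.

(** * Dyadic intervals and rectangles *)

Lemma dy_subproof (i k : nat) : (k %% 2 ^ i < 2 ^ i)%N.
Proof. by rewrite ltn_mod expn_gt0. Qed.

(** Reducing the index modulo $2^i$ makes dy total, so that indices can be
    computed in nat without carrying bounds. *)
Definition dy (i k : nat) : dyadic := existT _ i (Ordinal (dy_subproof i k)).

Lemma dyK (I : dyadic) : dy (tag I) (tagged I) = I.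
Proof.
by case: I => i k /=; congr existT; apply/val_inj; rewrite /= modn_small.
Qed.

Lemma dy_eq (I : dyadic) (k : nat) : (k < 2 ^ tag I)%N ->
  (I == dy (tag I) k) = (k == tagged I :> nat)%N.
Proof.
move=> kI; apply/eqP/eqP => [e|->]; last by rewrite dyK.
by rewrite e /= modn_small.
Qed.

Definition dseq (N : nat) : seq dyadic :=
  [seq dy i k | i <- iota 0 N.+1, k <- iota 0 (2 ^ i)].

Definition rseq (N : nat) : seq rect := [seq (K, L) | K <- dseq N, L <- dseq N].

Lemma mem_dseq N (I : dyadic) : (I \in dseq N) = (tag I <= N)%N.
Proof.
apply/allpairsPdep/idP => [[i [k [+ _ ->]]]|IN]; first by rewrite mem_iota.
exists (tag I), (nat_of_ord (tagged I)); rewrite !mem_iota !add0n ltnS IN.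
by rewrite ltn_ord dyK.
Qed.

Lemma dseq_uniq N : uniq (dseq N).
Proof.
apply: allpairs_uniq_dep => [|i _|]; rewrite ?iota_uniq//.
move=> [i k] [j l] /allpairsPdep[i' [k' [_ kI [e1 e2]]]].
move=> /allpairsPdep[j' [l' [_ lI [e3 e4]]]] /= e.
subst; have eij : i' = j' by have := congr1 tag e.
subst j'; move: kI lI; rewrite !mem_iota /= !add0n => kI lI.
have := dy_eq (I := dy i' k') kI; rewrite /= eqxx => /esym/eqP.
have := dy_eq (I := dy i' k') lI; rewrite /= -e eqxx => /esym/eqP -> <-.
by [].
Qed.

Lemma mem_rseq N (r : rect) : (r \in rseq N) = (tag r.1 <= N)%N && (tag r.2 <= N)%N.
Proof.
case: r => I J; rewrite -!mem_dseq.
by apply/allpairsP/andP => [[[I' J'] /= [? ? [-> ->]]]|[? ?]] //; exists (I, J).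
Qed.

Lemma rseq_uniq N : uniq (rseq N).
Proof. by apply: allpairs_uniq; rewrite ?dseq_uniq// => -[? ?] [? ?] _ _ [-> ->]. Qed.

Lemma big_rseqD1 (V : nmodType) N (r : rect) (F : rect -> V) : r \in rseq N ->
  \sum_(q <- rseq N) F q = F r + \sum_(q <- rseq N | q != r) F q.
Proof. by move=> rN; rewrite (bigD1_seq r rN) ?rseq_uniq. Qed.

(** * Haar functions on a grid *)

Section haar_on_grid.
Variable R : realType.
Implicit Types (I J : dyadic) (r q : rect) (G : nat).
Local Notation pt := (@grid_pt R).

Lemma rects_leE N r : rects_le R N r <-> r \in rseq N.
Proof.
rewrite mem_rseq /rects_le /= /dlen !lef_pV2 ?posrE ?exprn_gt0//.
by rewrite !ler_eXn2l ?ltr1n//; split => /andP.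
Qed.

Lemma fsum_rects_le (V : nmodType) N (F : rect -> V) :
  \sum_(r \in rects_le R N) F r = \sum_(r <- rseq N) F r.
Proof.
apply: fsbig_fwiden; rewrite ?rseq_uniq//; first by move=> r /rects_leE.
by move=> r [/= /rects_leE].
Qed.

Lemma pt_le_cell G k x i u : (i <= G)%N -> incell G k x ->
  (pt i u <= x) = (u * 2 ^ (G - i) <= k)%N.
Proof.
move=> iG /andP[kx xk].
have e : pt i u = pt G (u * 2 ^ (G - i)).
  rewrite /grid_pt natrM natrX -{2}(subnKC iG) exprD.
  by field; rewrite !expf_neq0.
have le a b : (pt G a <= pt G b) = (a <= b)%N.
  by rewrite ler_pM2r ?invr_gt0 ?exprn_gt0// ler_nat.
rewrite e; apply/idP/idP => [H|]; last by rewrite -le => /le_trans; apply.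
have := le_lt_trans H xk; rewrite ltNge le -ltnNge; exact.
Qed.

(** The value of $h_I$ on the v-th dyadic interval of half the length of I. *)
Definition haar_step I (v : nat) : R := (v == (tagged I).*2)%:R - (v == (tagged I).*2.+1)%:R.

Lemma haar1_cell I G k x : (tag I < G)%N -> incell G k x ->
  haar1 I x = haar_step I (k %/ 2 ^ (G - (tag I).+1))%N.
Proof.
move=> IG kx; case: I IG => i u /= iG.
have iG' := ltnW iG.
have h2 : (2 : R) != 0 by [].
have eL : dleft (existT _ i u) = pt i.+1 u.*2.
  rewrite /dleft /dlen /= /grid_pt -mul2n natrM exprS.
  by field; rewrite expf_neq0.
have eM : dmid (existT _ i u) = pt i.+1 u.*2.+1.
  rewrite /dmid eL /dlen /= /grid_pt exprS.
  by rewrite -[in RHS]addn1 natrD; field; rewrite expf_neq0.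
have eR : dright (existT _ i u) = pt i.+1 u.*2.+2.
  rewrite /dright eL /dlen /= /grid_pt exprS.
  by rewrite -[in RHS]addn2 natrD; field; rewrite expf_neq0.
have E a : (pt i.+1 a <= x) && (x < pt i.+1 a.+1) = (k %/ 2 ^ (G - i.+1) == a)%N.
  rewrite ltNge !(pt_le_cell _ _ kx)// -ltnNge.
  by rewrite -leq_divRL ?expn_gt0// -ltn_divLR ?expn_gt0// ltnS -eqn_leq eq_sym.
rewrite /haar1 eL eM eR !indicE !mem_setE !in_itv/= !E; exact.
Qed.

Lemma haar1_pt I G k : (tag I < G)%N ->
  haar1 I (pt G k) = haar_step I (k %/ 2 ^ (G - (tag I).+1))%N.
Proof. by move=> IG; apply: haar1_cell => //; exact: incell_pt. Qed.

(** The quotient is the index of the interval of the length of I that contains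
    the grid point $k 2^{-G}$. *)
Definition in_ivl G I (k : nat) : bool := (k %/ 2 ^ (G - tag I) == tagged I :> nat)%N.

Lemma haar1_sq I G k : (tag I < G)%N -> haar1 I (pt G k) ^+ 2 = (in_ivl G I k)%:R.
Proof.
move=> IG; rewrite haar1_pt// /in_ivl /haar_step.
have -> : (k %/ 2 ^ (G - tag I) = (k %/ 2 ^ (G - (tag I).+1))./2)%N.
  have -> a : (a./2 = a %/ 2 ^ 1)%N by rewrite expn1 divn2.
  by rewrite divn_pow2 addn1 subnSK.
move: (_ %/ _)%N => v; have vE := odd_double_half v.
case: eqP => [->|n1].
  rewrite doubleK eqxx; case: eqP => [e|_]; last by rewrite subr0 expr1n.
  by move: (congr1 odd e); rewrite /= odd_double.
case: eqP => [->|n2]; first by rewrite /= uphalf_double eqxx sub0r sqrrN expr1n.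
rewrite subr0 expr0n /=; case: eqP => // e; exfalso; rewrite -vE e in n1 n2.
by case: (odd v) n1 n2 => /=.
Qed.

Lemma sum_haar_step I n (F : nat -> R) : ((tagged I).*2.+1 < n)%N ->
  \sum_(v < n) F v * haar_step I v = F (tagged I).*2 - F (tagged I).*2.+1.
Proof.
move=> h; rewrite -(sum_delta F h) -(sum_delta F (ltnW h)) -sumrB.
by apply: eq_bigr => v _; rewrite mulrC /haar_step mulrBl.
Qed.

(** On the coarsest grid that resolves the finer of the two functions, that one has
    just two nonzero values, +1 and -1 at neighbouring points; the other function
    does not separate these points unless it lives on the same level. *)
Lemma haar1_orth I J G : (tag I < G)%N -> (tag J < G)%N ->
  2 ^- G * \sum_(k < 2 ^ G) haar1 I (pt G k) * haar1 J (pt G k) = (I == J)%:R * dlen I.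
Proof.
wlog IJ : I J / (tag I <= tag J)%N.
  move=> H IG JG; case/orP: (leq_total (tag I) (tag J)) => h; first exact: H.
  under eq_bigr do rewrite mulrC.
  by rewrite H// eq_sym; case: eqP => [->//|_]; rewrite !mul0r.
move=> IG JG.
have uJ : ((tagged J).*2.+1 < 2 ^ (tag J).+1)%N.
  by rewrite expnS mul2n -doubleS leq_double; exact: ltn_ord.
pose F v := haar_step I (v %/ 2 ^ (tag J - tag I))%N * haar_step J v.
transitivity (2 ^- G * (\sum_(k < 2 ^ G) F (k %/ 2 ^ (G - (tag J).+1))%N)).
  congr (_ * _); apply: eq_bigr => k _; rewrite !haar1_pt//=.
  by rewrite /F divn_pow2
    (_ : (G - (tag J).+1 + (tag J - tag I) = G - (tag I).+1)%N)//; lia.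
rewrite sum_pow2_div ?leq_subr// subKn// sumrMnl.
rewrite (@sum_haar_step J (2 ^ (tag J).+1) (fun v => haar_step I (v %/ 2 ^ (tag J - tag I))))//.
have [e|ne] := eqVneq (tag I) (tag J); last first.
  have -> : (I == J) = false by apply/eqP => e; rewrite e eqxx in ne.
  have -> : ((tagged J).*2.+1 %/ 2 ^ (tag J - tag I))%N
          = ((tagged J).*2 %/ 2 ^ (tag J - tag I))%N.
    have -> : (tag J - tag I = 1 + (tag J - (tag I).+1))%N by lia.
    by rewrite -!divn_pow2 expn1 !divn2 /= uphalf_double doubleK.
  by rewrite subrr mul0rn mulr0 mul0r.
have IK : dy (tag J) (tagged I) = I by rewrite -[RHS]dyK; congr dy.
have IJlt : (tagged I < 2 ^ tag J)%N.
  by apply: (leq_trans (ltn_ord (tagged I))); rewrite e.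
have -> : (I == J) = (tagged I == tagged J :> nat)%N.
  by rewrite eq_sym -{1}IK dy_eq.
have dE : dlen I = 2 ^- tag J :> R by rewrite /dlen e.
have e0 : (tag J - tag I = 0)%N by rewrite e subnn.
rewrite dE e0 expn0 !divn1 /haar_step.
rewrite !eqSS.
have -> : ((tagged J).*2 == (tagged I).*2.+1) = false.
  by apply/eqP => /(congr1 odd); rewrite /= !odd_double.
have -> : ((tagged J).*2.+1 == (tagged I).*2) = false.
  by apply/eqP => /(congr1 odd); rewrite /= !odd_double.
have -> : ((tagged J).*2 == (tagged I).*2) = (tagged I == tagged J :> nat).
  by rewrite eq_sym; apply/eqP/eqP => [/double_inj|->].
have -> : 2 ^+ G = 2 ^+ (G - (tag J).+1) * (2 * 2 ^+ tag J) :> R.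
  by rewrite -exprS -exprD subnK.
rewrite subr0 sub0r opprK -[X in _ * X = _]mulr_natr natrX.
by field; rewrite !expf_neq0.
Qed.

End haar_on_grid.

(** * Finite Haar sums and their norm *)

Section hardy.
Variable R : realType.
Implicit Types (r q : rect) (G N : nat) (a c : rect -> R).
Local Notation pt := (@grid_pt R).

Lemma eq_grid_mean G (F F' : nat -> nat -> R) :
  (forall k l, (k < 2 ^ G)%N -> (l < 2 ^ G)%N -> F k l = F' k l) ->
  grid_mean G F = grid_mean G F'.
Proof.
by move=> FF; congr (_ * _); apply: eq_bigr => l _; congr (_ * _);
  apply: eq_bigr => k _; exact: FF.
Qed.

Lemma le_grid_mean G (F F' : nat -> nat -> R) :
  (forall k l, (k < 2 ^ G)%N -> (l < 2 ^ G)%N -> F k l <= F' k l) ->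
  grid_mean G F <= grid_mean G F'.
Proof.
move=> FF; have h0 : 0 <= 2 ^- G :> R by rewrite invr_ge0 exprn_ge0.
rewrite /grid_mean; apply: ler_wpM2l => //; apply: ler_sum => l _.
by apply: ler_wpM2l => //; apply: ler_sum => k _; exact: FF.
Qed.

Lemma grid_mean_sum G (T : Type) (s : seq T) (P : pred T) (x : T -> R)
    (F : T -> nat -> nat -> R) :
  grid_mean G (fun k l => \sum_(i <- s | P i) x i * F i k l)
  = \sum_(i <- s | P i) x i * grid_mean G (F i).
Proof.
rewrite /grid_mean; under eq_bigr do rewrite exchange_big /= mulr_sumr.
rewrite exchange_big /= mulr_sumr; apply: eq_bigr => i _.
rewrite mulrCA; congr (_ * _); rewrite mulr_sumr; apply: eq_bigr => l _.
by rewrite mulrCA; congr (_ * _); rewrite mulr_sumr.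
Qed.

Lemma grid_meanZ G (x : R) (F : nat -> nat -> R) :
  grid_mean G (fun k l => x * F k l) = x * grid_mean G F.
Proof.
have := @grid_mean_sum G _ [:: tt] xpredT (fun=> x) (fun=> F).
rewrite big_seq1 => <-; apply: eq_grid_mean => k l _ _.
by rewrite big_seq1.
Qed.

Lemma grid_mean_cst G (x : R) : grid_mean G (fun _ _ => x) = x.
Proof.
rewrite /grid_mean !sumr_const !card_ord -[x *+ _]mulr_natr -[_ *+ (2 ^ G)]mulr_natr natrX.
by field; rewrite expf_neq0.
Qed.

Lemma grid_meanM G (F F' : nat -> R) : grid_mean G (fun k l => F k * F' l) =
  (2 ^- G * \sum_(k < 2 ^ G) F k) * (2 ^- G * \sum_(l < 2 ^ G) F' l).
Proof.
rewrite /grid_mean mulrCA; congr (_ * _); rewrite mulr_sumr; apply: eq_bigr => l _.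
by rewrite -mulrA -mulr_suml.
Qed.

Definition area r : R := dlen r.1 * dlen r.2.

Lemma dlen_gt0 (I : dyadic) : 0 < dlen I :> R.
Proof. by rewrite /dlen invr_gt0 exprn_gt0. Qed.

Lemma area_gt0 r : 0 < area r.
Proof. by rewrite mulr_gt0 ?dlen_gt0. Qed.

Definition in_rect G r (k l : nat) : bool := in_ivl G r.1 k && in_ivl G r.2 l.

Definition hsum N a : R * R -> R := \sum_(r <- rseq N) a r *: haar r.

Lemma hsumE N a p : hsum N a p = \sum_(r <- rseq N) a r * haar r p.
Proof. by rewrite /hsum fct_sumE. Qed.

Lemma rseq_ltG N G r : (N < G)%N -> r \in rseq N -> (tag r.1 < G)%N /\ (tag r.2 < G)%N.
Proof.
by rewrite mem_rseq => NG /andP[r1 r2]; split; apply: leq_ltn_trans NG.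
Qed.

Lemma haar_grid N G r : (N < G)%N -> r \in rseq N -> gridfun G (haar (R := R) r).
Proof.
move=> NG /(rseq_ltG NG)[r1 r2] k l x y kG lG kx ly; rewrite /haar /=.
by rewrite !(haar1_cell r1 kx) !(haar1_cell r2 ly) !haar1_pt.
Qed.

Lemma haar_sq N G r k l : (N < G)%N -> r \in rseq N ->
  haar r (pt G k, pt G l) ^+ 2 = (in_rect G r k l)%:R.
Proof.
move=> NG /(rseq_ltG NG)[r1 r2].
by rewrite /haar exprMn !haar1_sq// -natrM mulnb.
Qed.

Lemma grid_mean_haar N G r q : (N < G)%N -> r \in rseq N -> q \in rseq N ->
  grid_mean G (fun k l => haar r (pt G k, pt G l) * haar q (pt G k, pt G l))
  = (r == q)%:R * area r.
Proof.
move=> NG /(rseq_ltG NG)[r1 r2] /(rseq_ltG NG)[q1 q2].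
pose F k := haar1 r.1 (pt G k) * haar1 q.1 (pt G k).
pose F' k := haar1 r.2 (pt G k) * haar1 q.2 (pt G k).
transitivity (grid_mean G (fun k l => F k * F' l)).
  by apply: eq_grid_mean => k l _ _; rewrite /haar mulrACA.
rewrite grid_meanM /F /F' !haar1_orth// mulrACA -natrM mulnb.
by rewrite -pair_eqE.
Qed.

Lemma area_grid_mean N G r : (N < G)%N -> r \in rseq N ->
  area r = grid_mean G (fun k l => (in_rect G r k l)%:R).
Proof.
move=> NG rN; have := grid_mean_haar NG rN rN; rewrite eqxx mul1r => <-.
by apply: eq_grid_mean => k l _ _; rewrite -expr2 (haar_sq _ _ NG)//.
Qed.

(** Orthogonality of the Haar system, on a grid that resolves all the functions. *)
Lemma bracket_hsum N a c :
  bracket (hsum N a) (hsum N c) = \sum_(r <- rseq N) a r * c r * area r.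
Proof.
have NG := ltnSn N.
rewrite /bracket (@int2_grid _ N.+1); last first.
  move=> k l x y kG lG kx ly; rewrite !hsumE; congr (_ * _);
  by apply: eq_big_seq => r rN; congr (_ * _); exact: (haar_grid NG rN).
transitivity (grid_mean N.+1 (fun k l => \sum_(r <- rseq N) a r *
  (\sum_(q <- rseq N) c q * (haar r (pt N.+1 k, pt N.+1 l) * haar q (pt N.+1 k, pt N.+1 l))))).
  apply: eq_grid_mean => k l _ _; rewrite !hsumE mulr_suml; apply: eq_bigr => r _.
  rewrite -mulrA; congr (_ * _); rewrite mulr_sumr; apply: eq_bigr => q _.
  by rewrite mulrCA.
rewrite grid_mean_sum; apply: eq_big_seq => r rN; rewrite -mulrA; congr (_ * _).
rewrite grid_mean_sum (big_rseqD1 _ rN). rewrite (grid_mean_haar NG rN rN) eqxx mul1r.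
rewrite big_seq_cond big1 ?addr0// => q /andP[qN qr].
by rewrite (grid_mean_haar NG rN qN) eq_sym (negbTE qr) mul0r mulr0.
Qed.

(** Sums over different ranges of rectangles are compared by extending the
    coefficients by 0. *)
Definition trunc N a r : R := if r \in rseq N then a r else 0.

Lemma big_trunc N N' (V : nmodType) (F : R -> rect -> V) a : (N <= N')%N ->
  (forall r, F 0 r = 0) ->
  \sum_(r <- rseq N) F (a r) r = \sum_(r <- rseq N') F (trunc N a r) r.
Proof.
move=> NN F0.
rewrite [RHS](bigID (mem (rseq N)))/= [X in _ + X]big1 ?addr0; last first.
  by move=> r /negbTE; rewrite /trunc => ->.
rewrite -[RHS]big_filter; under [RHS]eq_big_seq => r.
  by rewrite mem_filter => /andP[rN _]; rewrite /trunc rN; over.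
apply: perm_big; rewrite uniq_perm ?filter_uniq ?rseq_uniq// => r.
rewrite mem_filter !mem_rseq.
apply/idP/andP => [/andP[r1 r2]|[]//]; split; first by rewrite r1.
by rewrite (leq_trans r1 NN) (leq_trans r2 NN).
Qed.

Lemma hsum_widen N N' a : (N <= N')%N -> hsum N a = hsum N' (trunc N a).
Proof.
move=> NN; rewrite /hsum (big_trunc (F := fun x r => x *: haar r) a NN)//.
by move=> r; rewrite scale0r.
Qed.

Lemma hsum_inj N a c : hsum N a = hsum N c -> {in rseq N, a =1 c}.
Proof.
move=> ac r rN; pose d q : R := (q == r)%:R.
have E x : bracket (hsum N x) (hsum N d) = x r * area r.
  rewrite bracket_hsum (big_rseqD1 _ rN) /d eqxx mulr1.
  by rewrite big1 ?addr0// => q /negbTE ->; rewrite mulr0 mul0r.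
by apply: (mulIf (lt0r_neq0 (area_gt0 r))); rewrite -!E ac.
Qed.

Lemma hsum_lin N a c x : x *: hsum N a + hsum N c = hsum N (fun r => x * a r + c r).
Proof.
rewrite /hsum scaler_sumr -big_split /=; apply: eq_bigr => r _.
by rewrite scalerDl scalerA.
Qed.

Lemma hsum0 N : hsum N (fun=> 0) = 0.
Proof. by rewrite /hsum big1// => r _; rewrite scale0r. Qed.

Lemma hsumZ N a x : x *: hsum N a = hsum N (fun r => x * a r).
Proof. by rewrite /hsum scaler_sumr; apply: eq_bigr => r _; rewrite scalerA. Qed.

Lemma hsum_sum N (T : Type) (s : seq T) (x : T -> R) (A : T -> rect -> R) :
  \sum_(i <- s) x i *: hsum N (A i) = hsum N (fun r => \sum_(i <- s) x i * A i r).
Proof.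
under eq_bigr do rewrite /hsum scaler_sumr.
rewrite exchange_big /hsum; apply: eq_bigr => r _.
by rewrite scaler_suml; apply: eq_bigr => i _; rewrite scalerA.
Qed.

Lemma finite_rects_bound (A : set rect) N : finite_set A ->
  exists2 N', (N <= N')%N & forall r, A r -> r \in rseq N'.
Proof.
move=> /finite_seqP[s ->].
exists (\max_(r <- s) maxn (tag r.1) (tag r.2) + N)%N; first exact: leq_addl.
move=> r /= rs; rewrite mem_rseq -geq_max.
by apply: leq_trans (leq_addr _ _); exact: leq_bigmax_seq.
Qed.

Definition sqfun N a (p : R * R) := Num.sqrt (\sum_(r <- rseq N) a r ^+ 2 * haar r p ^+ 2).

(** Brackets with Haar functions recover the coefficients, hence any two
    expansions of a function have the same square function. *)
Lemma H1norm_int N a : H1norm (hsum N a) = int2 (sqfun N a).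
Proof.
have W (B : set rect) N' d (V : nmodType) (F : R -> rect -> V) :
    (forall r, B r -> r \in rseq N') -> (forall r, F 0 r = 0) ->
    \sum_(r \in B) F (d r) r = \sum_(r <- rseq N') F (if r \in B then d r else 0) r.
  move=> BN F0.
  transitivity (\sum_(r \in B) F (if r \in B then d r else 0) r).
    by apply: eq_fsbigr => r ->.
  apply: fsbig_fwiden; rewrite ?rseq_uniq//.
  by move=> r [_ rB] /=; rewrite memNset.
apply: xget_unique => [|x [A [d [Afin fE ->]]]]; last first.
  have [N' NN AN] := finite_rects_bound N Afin.
  congr int2; apply/funext => p; congr Num.sqrt.
  rewrite (W _ _ _ _ (fun x r => x ^+ 2 * haar r p ^+ 2) AN); last first.
    by move=> r; rewrite expr0n mul0r.
  rewrite (big_trunc (F := fun x r => x ^+ 2 * haar r p ^+ 2) a NN); last first.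
    by move=> r; rewrite expr0n mul0r.
  apply: eq_big_seq => r rN; congr (_ ^+ 2 * _).
  move: r rN; apply: hsum_inj; rewrite -hsum_widen// fE.
  by rewrite (W _ _ _ _ (fun x r => x *: haar r) AN)// => r; rewrite scale0r.
exists [set` rseq N], a; split; first exact: finite_seq.
- by rewrite -fsbig_seq ?rseq_uniq.
- congr int2; apply/funext => p; congr Num.sqrt.
  by rewrite -fsbig_seq ?rseq_uniq.
Qed.

(** The square of the square function, at a grid point: the Haar functions enter only
    through the supports of their squares. *)
Definition sqfun2 G N a (k l : nat) : R := \sum_(r <- rseq N) a r ^+ 2 * (in_rect G r k l)%:R.

Lemma H1norm_hsum N G a : (N < G)%N ->
  H1norm (hsum N a) = grid_mean G (fun k l => Num.sqrt (sqfun2 G N a k l)).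
Proof.
move=> NG; rewrite H1norm_int (@int2_grid _ G).
  apply: eq_grid_mean => k l _ _; congr Num.sqrt; apply: eq_big_seq => r rN.
  by rewrite (haar_sq _ _ NG)//.
move=> k l x y kG lG kx ly; congr Num.sqrt; apply: eq_big_seq => r rN.
by congr (_ * _ ^+ 2); apply: (haar_grid NG rN).
Qed.

Lemma lspan_sub (V : lmodType R) (A B : set V) : A `<=` B -> B 0 ->
  (forall x u v, B u -> B v -> B (x *: u + v)) -> lspan A `<=` B.
Proof.
move=> AB B0 BD f [m [x [w [Aw ->]]]].
elim/big_ind: _ => // [u v Bu Bv|i _]; first by rewrite -[u]scale1r; exact: BD.
by rewrite -[_ *: _]addr0; apply: BD => //; apply/AB/Aw.
Qed.

Lemma lspan_seq (V : lmodType R) (A : set V) (T : eqType) (s : seq T)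
    (x : T -> R) (w : T -> V) :
  (forall i, i \in s -> A (w i)) -> lspan A (\sum_(i <- s) x i *: w i).
Proof.
move=> Aw; exists (size s), (fun i => x (tnth (in_tuple s) i)),
  (fun i => w (tnth (in_tuple s) i)); split.
  by move=> i; apply: Aw; rewrite mem_tnth.
by rewrite big_tnth.
Qed.

Lemma haar_hsum N r : r \in rseq N -> haar r = hsum N (fun q => (q == r)%:R).
Proof.
move=> rN; rewrite /hsum (big_rseqD1 _ rN) eqxx scale1r.
by rewrite big1 ?addr0// => q /negbTE ->; rewrite scale0r.
Qed.

Lemma H1nP N (f : R * R -> R) : H1n N f <-> exists a, f = hsum N a.
Proof.
split=> [|[a ->]]; last first.
  by apply: lspan_seq => r rN; exists r => //; apply/rects_leE.
move: f; apply: lspan_sub.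
- move=> _ [r /rects_leE rN <-]; exists (fun q => (q == r)%:R); exact: haar_hsum.
- by exists (fun=> 0); rewrite hsum0.
- by move=> x _ _ [a ->] [c ->]; eexists; exact: hsum_lin.
Qed.

Lemma haar_spanP (f : R * R -> R) N : haar_span f ->
  exists N' a, (N <= N')%N /\ f = hsum N' a.
Proof.
suff : (haar_span : set (R * R -> R)) `<=` [set f | exists N' a, (N <= N')%N /\ f = hsum N' a].
  by apply.
apply: lspan_sub.
- move=> _ [r _ <-]; have [N' NN rN] := finite_rects_bound N (finite_set1 r).
  by exists N', (fun q => (q == r)%:R); split=> //; apply: haar_hsum; exact: rN.
- by exists N, (fun=> 0); rewrite hsum0.
- move=> x _ _ [N1 [a1 [NN1 ->]]] [N2 [a2 [NN2 ->]]].
  exists (maxn N1 N2); rewrite (hsum_widen a1 (leq_maxl N1 N2)).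
  rewrite (hsum_widen a2 (leq_maxr N1 N2)) hsum_lin; eexists; split=> //.
  exact: leq_trans NN1 (leq_maxl _ _).
Qed.

Lemma hsum_span N a : haar_span (hsum N a).
Proof. by apply: lspan_seq => r _; exists r. Qed.

End hardy.

(** * Euclidean norms of finite families *)

Section ell2.
Variable R : realType.

Lemma sum_CauchySchwarz (T : Type) (s : seq T) (x y : T -> R) :
  (\sum_(i <- s) x i * y i) ^+ 2 <= (\sum_(i <- s) x i ^+ 2) * \sum_(i <- s) y i ^+ 2.
Proof.
have E b c : \sum_(i <- s) (b * x i - c * y i) ^+ 2 =
    b ^+ 2 * (\sum_(i <- s) x i ^+ 2) + c ^+ 2 * (\sum_(i <- s) y i ^+ 2)
    - (b * c) *+ 2 * (\sum_(i <- s) x i * y i).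
  by rewrite !mulr_sumr -big_split -sumrB; apply: eq_bigr => i _ /=; ring.
set A := \sum_(i <- s) x i ^+ 2; set B := \sum_(i <- s) y i ^+ 2.
set C := \sum_(i <- s) x i * y i.
have B0 : 0 <= B by apply: sumr_ge0 => i _; exact: sqr_ge0.
(* The vector B x - C y is B times the component of x orthogonal to y. *)
have : 0 <= \sum_(i <- s) (B * x i - C * y i) ^+ 2.
  by apply: sumr_ge0 => i _; exact: sqr_ge0.
have -> : \sum_(i <- s) (B * x i - C * y i) ^+ 2 = B * (A * B - C ^+ 2).
  by rewrite E -/A -/B -/C; ring.
move: B0; rewrite le_eqVlt => /predU1P[B0 _|B0]; last first.
  by rewrite pmulr_rge0// subr_ge0.
suff -> : C = 0 by rewrite expr0n -B0 mulr0.
rewrite /C; elim: s {E} @A @B @C B0 => [|i s IH] /=; first by rewrite !big_nil.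
rewrite !big_cons => /esym/eqP.
rewrite paddr_eq0 ?sqr_ge0//; last by apply: sumr_ge0 => j _; exact: sqr_ge0.
by rewrite sqrf_eq0 => /andP[/eqP -> /eqP/esym/IH ->]; rewrite mulr0 addr0.
Qed.

Lemma sum_mul_le_sqrt (T : Type) (s : seq T) (x y : T -> R) :
  \sum_(i <- s) x i * y i <=
  Num.sqrt (\sum_(i <- s) x i ^+ 2) * Num.sqrt (\sum_(i <- s) y i ^+ 2).
Proof.
rewrite -sqrtrM; last by apply: sumr_ge0 => i _; exact: sqr_ge0.
apply: (le_trans (ler_norm _)); rewrite -sqrtr_sqr ler_wsqrtr//.
exact: sum_CauchySchwarz.
Qed.

Lemma sqrt_sum_sqrD (T : Type) (s : seq T) (x y : T -> R) :
  Num.sqrt (\sum_(i <- s) (x i + y i) ^+ 2) <=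
  Num.sqrt (\sum_(i <- s) x i ^+ 2) + Num.sqrt (\sum_(i <- s) y i ^+ 2).
Proof.
have S0 (z : T -> R) : 0 <= \sum_(i <- s) z i ^+ 2.
  by apply: sumr_ge0 => i _; exact: sqr_ge0.
rewrite -[leRHS]ger0_norm ?addr_ge0 ?sqrtr_ge0// -sqrtr_sqr ler_wsqrtr//.
rewrite sqrrD !sqr_sqrtr//.
have -> : \sum_(i <- s) (x i + y i) ^+ 2 = \sum_(i <- s) x i ^+ 2 +
    (\sum_(i <- s) x i * y i) *+ 2 + \sum_(i <- s) y i ^+ 2.
  by rewrite -sumrMnl -!big_split; apply: eq_bigr => i _; rewrite sqrrD.
by rewrite lerD2r lerD2l ler_wMn2r// sum_mul_le_sqrt.
Qed.

(** Convexity of the Euclidean norm. This is all that the norm bound for the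
    projection needs about square functions. *)
Lemma sqrt_sum_sqr_convex (T U : Type) (s : seq T) (t : seq U) (w : U -> R)
    (x : T -> U -> R) : (forall k, 0 <= w k) ->
  Num.sqrt (\sum_(i <- s) (\sum_(k <- t) w k * x i k) ^+ 2) <=
  \sum_(k <- t) w k * Num.sqrt (\sum_(i <- s) x i k ^+ 2).
Proof.
move=> w0; elim: t => [|k t IH].
  under eq_bigr do rewrite big_nil expr0n /=.
  by rewrite big1// sqrtr0 big_nil.
under eq_bigr do rewrite big_cons.
apply: (le_trans (sqrt_sum_sqrD _ _ _)); rewrite big_cons lerD//.
under eq_bigr do rewrite exprMn.
by rewrite -mulr_sumr sqrtrM ?sqr_ge0// sqrtr_sqr ger0_norm.
Qed.

(** At most one summand is nonzero. *)
Lemma sqr_sum_disjoint (T : eqType) (s : seq T) (P : pred T) (x : T -> R) :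
  uniq s -> {in s &, forall i j, P i -> P j -> i = j} ->
  (\sum_(i <- s) x i * (P i)%:R) ^+ 2 = \sum_(i <- s) x i ^+ 2 * (P i)%:R.
Proof.
elim: s => [|i s IH] /=; first by rewrite !big_nil expr0n.
move=> /andP[is_ us] PP; rewrite !big_cons.
case Pi: (P i); last first.
  rewrite !mulr0 !add0r IH// => j k js ks; apply: PP; exact: mem_behead.
have Z (y : T -> R) : \sum_(j <- s) y j * (P j)%:R = 0.
  rewrite big_seq big1// => j js; case Pj: (P j); rewrite ?mulr0//.
  by move: is_; rewrite (PP i j)// ?js// ?mem_head// inE js orbT.
by rewrite !Z !addr0 !mulr1.
Qed.

Lemma sum_disjoint_le1 (T : eqType) (s : seq T) (P : pred T) :
  uniq s -> {in s &, forall i j, P i -> P j -> i = j} ->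
  \sum_(i <- s) (P i)%:R <= 1 :> R.
Proof.
move=> us PP; have := sqr_sum_disjoint (fun=> 1) us PP.
under eq_bigr do rewrite mul1r.
under [in RHS]eq_bigr do rewrite expr1n mul1r.
set S := \sum_(i <- s) _ => SS; have : S * (S - 1) = 0 by rewrite mulrBr -expr2 SS mulr1 subrr.
by move/eqP; rewrite mulf_eq0 subr_eq0 => /orP[|] /eqP ->.
Qed.

End ell2.

(** * Equidistribution of selected digits *)

(** For the point x of index k on the grid of mesh $2^{-iW}$, digits W i k is the
    i-digit binary number formed by the digits of x at the positions W, 2W, .., iW. *)
Fixpoint digits (W i k : nat) : nat :=
  if i is i'.+1 then ((digits W i' (k %/ 2 ^ W)).*2 + odd k)%N else 0%N.

Lemma digits_lt W i k : (digits W i k < 2 ^ i)%N.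
Proof.
elim: i k => [|i IH] k //=; have := IH (k %/ 2 ^ W)%N.
by rewrite expnS; case: odd; lia.
Qed.

(** The leading digits of a selection are the selection of the leading digits. *)
Lemma digits_prefix W i d k : (digits W (i + d) k %/ 2 ^ d)%N = digits W i (k %/ 2 ^ (d * W)).
Proof.
elim: d k => [|d IH] k; first by rewrite addn0 mul0n !expn0 !divn1.
have e : (2 ^ d.+1 = 2 ^ (1 + d))%N by [].
rewrite addnS /= e -divn_pow2 expn1 divn2 halfD odd_double doubleK /=.
have -> : ((odd k)./2 = 0)%N by case: odd.
by rewrite !addn0 add0n IH divn_pow2 -mulSn.
Qed.

Section equidistribution.
Variables (R : realType) (W : nat).
Hypothesis W0 : (0 < W)%N.

(** The digit at position (p+1)W is the last bit of the index at that level, and it is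
    independent of all the preceding bits. As m < (p+1)W, the function g sees only
    preceding bits, so that fixing this digit as well halves the sum. *)
Lemma digits_halve G p m (q : nat) (g : nat -> R) : (m < p.+1 * W)%N -> (p.+1 * W <= G)%N ->
  2 * \sum_(k < 2 ^ G) g (k %/ 2 ^ (G - m))%N *
        (digits W p.+1 (k %/ 2 ^ (G - p.+1 * W))%N == q)%N%:R
  = \sum_(k < 2 ^ G) g (k %/ 2 ^ (G - m))%N *
        (digits W p (k %/ 2 ^ (G - p * W))%N == q %/ 2)%N%:R.
Proof.
move=> mp pG; set s := (G - p.+1 * W)%N.
have sG : (s <= G)%N by exact: leq_subr.
(* Both summands depend on k only through its prefix x of length (p+1)W. *)
pose F1 x := g (x %/ 2 %/ 2 ^ (p.+1 * W - m).-1)%N * (digits W p.+1 x == q)%N%:R.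
pose F2 x := g (x %/ 2 %/ 2 ^ (p.+1 * W - m).-1)%N *
   (digits W p (x %/ 2 ^ W) == q %/ 2)%N%:R.
have D k : (k %/ 2 ^ s %/ 2 %/ 2 ^ (p.+1 * W - m).-1 = k %/ 2 ^ (G - m))%N.
  rewrite -[X in (_ %/ X %/ _)%N](expn1 2) !divn_pow2; congr (_ %/ 2 ^ _)%N.
  by rewrite /s; lia.
transitivity (2 * \sum_(k < 2 ^ G) F1 (k %/ 2 ^ s)%N).
  by congr (_ * _); apply: eq_bigr => k _; rewrite /F1 D.
transitivity (\sum_(k < 2 ^ G) F2 (k %/ 2 ^ s)%N); last first.
  apply: eq_bigr => k _; rewrite /F2 D divn_pow2; congr (_ * (digits _ _ (_ %/ 2 ^ _) == _)%N%:R).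
  by rewrite /s; move: mp pG; rewrite mulSn; lia.
rewrite !sum_pow2_div//. rewrite !sumrMnl mulrnAr; congr (_ *+ _).
have -> : (2 ^ (G - s) = 2 ^ (p.+1 * W).-1 * 2)%N.
  by rewrite -expnSr; congr (2 ^ _)%N; rewrite /s; lia.
rewrite !sum_ord_mul mulr_sumr; apply: eq_bigr => u _.
rewrite !big_ord_recl !big_ord0 !addr0 /= /F1 /F2 /= addn0 /bump /=.
have h1 : ((u * 2) %/ 2 = u)%N by rewrite mulnK.
have h2 : ((u * 2 + 1) %/ 2 = u)%N by rewrite divnMDl// addn0.
have hW x : (x %/ 2 ^ W = x %/ 2 %/ 2 ^ W.-1)%N.
  by rewrite -[X in (_ %/ X %/ _)%N](expn1 2) divn_pow2 add1n prednK.
rewrite !hW h1 h2 oddD oddM andbF /=.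
set a := digits _ _ _; set gu := g _.
have := divn_eq q 2; rewrite modn2; case: (odd q) => /= qE.
  have -> : (a.*2 + 0 == q)%N = false by apply/eqP; lia.
  have -> : (a.*2 + 1 == q)%N = (a == q %/ 2)%N by apply/eqP/eqP; lia.
  by rewrite /= mulr0n; ring.
have -> : (a.*2 + 1 == q)%N = false by apply/eqP; lia.
have -> : (a.*2 + 0 == q)%N = (a == q %/ 2)%N by apply/eqP/eqP; lia.
by rewrite /= mulr0n; ring.
Qed.

(** Iterates digits_halve over the d digits that follow the first i ones. In words of
    probability: a function of the first m < (i+1)W bits has the same conditional
    expectation given i + d selected digits as given the first i of them. *)
Lemma digits_equidistributed G i d m (q : nat) (g : nat -> R) :
  (m < i.+1 * W)%N -> ((i + d) * W <= G)%N ->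
  2 ^+ d * \sum_(k < 2 ^ G) g (k %/ 2 ^ (G - m))%N *
        (digits W (i + d) (k %/ 2 ^ (G - (i + d) * W))%N == q)%N%:R
  = \sum_(k < 2 ^ G) g (k %/ 2 ^ (G - m))%N *
        (digits W i (k %/ 2 ^ (G - i * W))%N == q %/ 2 ^ d)%N%:R.
Proof.
move=> mi; elim: d q => [|d IH] q idG.
  by rewrite expr0 mul1r addn0 expn0 divn1.
rewrite exprSr -mulrA addnS digits_halve; last 2 first.
- by apply: leq_trans mi _; rewrite leq_mul2r; lia.
- by rewrite -addnS.
rewrite IH; last by apply: leq_trans idG; rewrite leq_mul2r; lia.
by rewrite -[X in (_ %/ X %/ _)%N](expn1 2) divn_pow2 add1n.
Qed.

(** The selected digits are distributed like the leading n digits: the map that they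
    define preserves Lebesgue measure. *)
Lemma digits_uniform G n (F : nat -> R) : (n * W <= G)%N -> (n <= G)%N ->
  \sum_(k < 2 ^ G) F (digits W n (k %/ 2 ^ (G - n * W))%N)
  = \sum_(k < 2 ^ G) F (k %/ 2 ^ (G - n))%N.
Proof.
move=> nWG ltn_nG; rewrite sum_pow2_div ?leq_subr// subKn//.
transitivity (\sum_(k < 2 ^ G) \sum_(q < 2 ^ n)
    F q * (digits W n (k %/ 2 ^ (G - n * W)) == q)%N%:R).
  apply: eq_bigr => k _; rewrite -(sum_delta F (digits_lt W n (k %/ 2 ^ (G - n * W)))).
  by apply: eq_bigr => q _; rewrite mulrC eq_sym.
rewrite exchange_big /=; apply: eq_bigr => q _; rewrite -mulr_sumr -mulr_natr.
congr (_ * _).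
have := @digits_equidistributed G 0 n 0 q (fun=> 1).
rewrite add0n mul1n => /(_ W0 nWG).
under eq_bigr do rewrite mul1r.
under [in RHS]eq_bigr do rewrite mul1r (divn_small (ltn_ord q)) eqxx.
rewrite sumr_const card_ord natrX => e.
have n0 : (2 : R) ^+ n != 0 by rewrite expf_neq0.
apply: (mulfI n0); rewrite e -exprD subnKC// natrX.
by [].
Qed.

End equidistribution.

(** * Blocks of Haar functions *)

(** The rectangles K x J, with K of length $2^{-m}$, whose ancestor of length
    $2^{-iW}$ has the index of I as its selected digits; here r = I x J and i is the
    level of I. The second factor is left as it is. *)
Definition inblock W (r : rect) m : pred rect := fun q =>
  [&& tag q.1 == m, q.2 == r.2 &
      digits W (tag r.1) (tagged q.1 %/ 2 ^ (m - tag r.1 * W))%N == tagged r.1 :> nat].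

(** The frequency of a block comes after the i digits that cut out its support, and
    before the next selected digit. *)
Definition admissible W (r : rect) m := (tag r.1 * W <= m < (tag r.1).+1 * W)%N.

(** Membership of a grid point in the support of the block of r. *)
Definition block_cell W G (r : rect) (k l : nat) : bool :=
  (digits W (tag r.1) (k %/ 2 ^ (G - tag r.1 * W)) == tagged r.1 :> nat)%N && in_ivl G r.2 l.

(** The frequency windows of different levels are disjoint, so m determines the level
    of I; the selected digits then determine I. *)
Lemma inblock_inj W r m r' m' q : admissible W r m -> admissible W r' m' ->
  inblock W r m q -> inblock W r' m' q -> r = r' /\ m = m'.
Proof.
case: r r' => I J [I' J'] /andP[/= m1 m2] /andP[/= m1' m2'].
move=> /and3P[/= /eqP mE /eqP <- /eqP e] /and3P[/= /eqP mE' /eqP <- /eqP e'].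
have freq' : m = m' by rewrite -mE.
split=> //; congr pair; rewrite -freq' in m1' m2' e'.
have II : tag I = tag I'.
  move: (leq_ltn_trans m1 m2') (leq_ltn_trans m1' m2).
  by rewrite !ltn_mul2r => /andP[_ h1] /andP[_ h2]; lia.
by rewrite -(dyK I) -(dyK I') -e -e' II.
Qed.

Section blocks.
Variables (R : realType) (W n N G : nat).
Hypotheses (W0 : (0 < W)%N) (nN : (n.+1 * W <= N)%N) (NG : (N < G)%N).
Implicit Types (r q : rect) (a : rect -> R).

Lemma mean_in_ivl (J : dyadic) : (tag J < G)%N ->
  2 ^- G * \sum_(l < 2 ^ G) (in_ivl G J l)%:R = dlen J :> R.
Proof.
move=> JG; have := haar1_orth R JG JG; rewrite eqxx mul1r => <-.
by congr (_ * _); apply: eq_bigr => l _; rewrite -expr2 haar1_sq.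
Qed.

Lemma leq_nN : (n <= N)%N.
Proof. by apply: leq_trans nN; rewrite mulSn (leq_trans (leq_pmulr n W0))// leq_addl. Qed.

Lemma admissible_lt r m : r \in rseq n -> admissible W r m -> (m < n.+1 * W)%N.
Proof.
rewrite mem_rseq => /andP[rn _] /andP[_ h]; apply: leq_trans h _.
by rewrite leq_mul2r ltnS rn orbT.
Qed.

(** The rectangles of a block tile its support, so that a grid point sees exactly one
    of them. *)
Lemma sum_inblock (V : nzRingType) (F : rect -> V) r m k l :
  r \in rseq n -> admissible W r m -> (k < 2 ^ G)%N ->
  \sum_(q <- rseq N) F q * (inblock W r m q && in_rect G q k l)%:R
  = F (dy m (k %/ 2 ^ (G - m)), r.2) * (block_cell W G r k l)%:R.
Proof.
move=> rn rm kG; (* q0 is the rectangle of the block above the grid point. *)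
set q0 := (_, _).
have mN : (m <= N)%N by apply: leq_trans (ltnW (admissible_lt rn rm)) nN.
have q0N : q0 \in rseq N.
  move: rn; rewrite !mem_rseq /= mN => /andP[_ /leq_trans]; apply; exact: leq_nN.
have mG : (m <= G)%N by apply: leq_trans mN (ltnW NG).
have xm : (k %/ 2 ^ (G - m) < 2 ^ m)%N.
  by rewrite ltn_divLR ?expn_gt0// -expnD subnKC.
rewrite (big_rseqD1 _ q0N) big1 ?addr0.
  congr (_ * _%:R); congr (nat_of_bool _).
  rewrite /inblock /in_rect /block_cell /= !eqxx /= /in_ivl /= modn_small// eqxx /=.
  rewrite divn_pow2; congr ((digits _ _ (_ %/ 2 ^ _) == _)%N && _).
  by case/andP: rm => [h _]; lia.
move=> q qq; case: andP => [[/and3P[/eqP e1 /eqP e2 _] /andP[/eqP e3 _]]|_]; last by rewrite mulr0.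
case/eqP: qq; case: q e1 e2 e3 => [K L] /= e1 -> e3; congr pair.
by rewrite -(dyK K) -e3 e1.
Qed.

(** Blocks are disjoint sets of rectangles, so the square function of a combination of
    blocks sees each of them separately. *)
Lemma sqfun2_blocks (T : eqType) (s : seq T) (rr : T -> rect) (freq : T -> nat) (x : T -> R) k l :
  uniq s -> (forall i, i \in s -> rr i \in rseq n /\ admissible W (rr i) (freq i)) ->
  {in s &, forall i j, rr i = rr j -> freq i = freq j -> i = j} -> (k < 2 ^ G)%N ->
  sqfun2 G N (fun q => \sum_(i <- s) x i * (inblock W (rr i) (freq i) q)%:R) k l
  = \sum_(i <- s) x i ^+ 2 * (block_cell W G (rr i) k l)%:R.
Proof.
move=> us ok inj kG; rewrite /sqfun2.
under eq_bigr => q _.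
  rewrite (sqr_sum_disjoint (P := fun i => inblock W (rr i) (freq i) q) x us).
    rewrite mulr_suml; under eq_bigr do rewrite -mulrA -natrM mulnb; over.
  move=> i j si sj bi bj; have [? oki] := ok i si; have [? okj] := ok j sj.
  by have [] := inblock_inj oki okj bi bj; exact: inj.
rewrite exchange_big; apply: eq_big_seq => i si; have [ri oki] := ok i si.
rewrite -mulr_sumr; congr (_ * _).
have := sum_inblock (fun=> 1 : R) l ri oki kG; rewrite mul1r => <-.
by apply: eq_bigr => q _; rewrite mul1r.
Qed.

(** The index, on the grid of mesh $2^{-(n+1)}$, of the image of a grid point under the
    map that reads off the selected digits. *)
Definition coarse k := digits W n.+1 (k %/ 2 ^ (G - n.+1 * W)).

Definition coarse_cell r (x l : nat) : bool :=
  (x %/ 2 ^ (n.+1 - tag r.1) == tagged r.1 :> nat)%N && in_ivl G r.2 l.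

Lemma digits_coarse r k : r \in rseq n ->
  digits W (tag r.1) (k %/ 2 ^ (G - tag r.1 * W))%N = (coarse k %/ 2 ^ (n.+1 - tag r.1))%N.
Proof.
rewrite mem_rseq => /andP[rn _].
rewrite /coarse -[in digits W n.+1](@subnKC (tag r.1) n.+1) ?leqW//.
rewrite digits_prefix divn_pow2; congr (digits _ _ (_ %/ 2 ^ _)).
have : ((n.+1 - tag r.1) * W + tag r.1 * W = n.+1 * W)%N by rewrite -mulnDl subnK// leqW.
by move: nN NG; move: ((_ - _) * W)%N (tag r.1 * W)%N (n.+1 * W)%N; lia.
Qed.

Lemma block_cell_coarse r k l : r \in rseq n ->
  block_cell W G r k l = coarse_cell r (coarse k) l.
Proof. by move=> rn; rewrite /block_cell digits_coarse. Qed.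

Lemma ltn_nG : (n < G)%N.
Proof. exact: leq_ltn_trans leq_nN NG. Qed.

Lemma in_rect_coarse r k l : r \in rseq n ->
  in_rect G r k l = coarse_cell r (k %/ 2 ^ (G - n.+1)) l.
Proof.
rewrite mem_rseq => /andP[rn _]; rewrite /in_rect /coarse_cell divn_pow2 {1}/in_ivl.
by congr ((_ %/ 2 ^ _ == _)%N && _); have := ltn_nG; lia.
Qed.

Lemma grid_mean_coarse (F : nat -> nat -> R) :
  grid_mean G (fun k l => F (coarse k) l) = grid_mean G (fun k l => F (k %/ 2 ^ (G - n.+1))%N l).
Proof.
congr (_ * _); apply: eq_bigr => l _; congr (_ * _).
apply: (digits_uniform W0 (F ^~ l)); last exact: ltn_nG.
exact: leq_trans nN (ltnW NG).
Qed.

Lemma grid_mean_block_cell r : r \in rseq n ->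
  grid_mean G (fun k l => (block_cell W G r k l)%:R) = area R r.
Proof.
move=> rn; rewrite (area_grid_mean _ ltn_nG rn).
transitivity (grid_mean G (fun k l => (coarse_cell r (coarse k) l)%:R : R)).
  by apply: eq_grid_mean => k l _ _; rewrite block_cell_coarse.
rewrite (grid_mean_coarse (fun x l => (coarse_cell r x l)%:R)).
by apply: eq_grid_mean => k l _ _; rewrite in_rect_coarse.
Qed.

Definition blockfun r m : R * R -> R := hsum N (fun q => (inblock W r m q)%:R).

Lemma bracket_blockfun a r m : r \in rseq n -> admissible W r m ->
  bracket (hsum N a) (blockfun r m)
  = grid_mean G (fun k l => a (dy m (k %/ 2 ^ (G - m)), r.2) * (block_cell W G r k l)%:R).
Proof.
move=> rn rm; rewrite /blockfun bracket_hsum.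
transitivity (\sum_(q <- rseq N) (a q * (inblock W r m q)%:R) *
    grid_mean G (fun k l => (in_rect G q k l)%:R)).
  by apply: eq_big_seq => q qN; rewrite -(area_grid_mean _ NG qN).
rewrite -grid_mean_sum; apply: eq_grid_mean => k l kG _.
rewrite -(sum_inblock _ _ rn rm kG); apply: eq_bigr => q _.
by rewrite -mulrA -natrM mulnb.
Qed.

(** The support of a block has the area of the rectangle that indexes it. *)
Lemma bracket_blockfun_diag r m : r \in rseq n -> admissible W r m ->
  bracket (blockfun r m) (blockfun r m) = area R r.
Proof.
move=> rn rm; rewrite -(grid_mean_block_cell rn) /blockfun bracket_hsum.
have := bracket_blockfun (fun=> 1) rn rm; rewrite bracket_hsum => e.
transitivity (\sum_(r0 <- rseq N) 1 * (inblock W r m r0)%:R * area R r0).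
  by apply: eq_bigr => q _; rewrite mul1r -natrM mulnb andbb.
by rewrite e; apply: eq_grid_mean => k l _ _; rewrite mul1r.
Qed.

Lemma bracket_blockfun_off r m r' m' : admissible W r m -> admissible W r' m' -> r != r' ->
  bracket (blockfun r m) (blockfun r' m') = 0.
Proof.
move=> rm rm' rr; rewrite /blockfun bracket_hsum big1// => q _.
case bq: (inblock W r m q); last by rewrite !mul0r.
case bq': (inblock W r' m' q); last by rewrite mulr0 mul0r.
by have [e _] := inblock_inj rm rm' bq bq'; rewrite e eqxx in rr.
Qed.

(** Cauchy-Schwarz at each point: the easy half of the duality between $H^1$ and the
    functions with bounded square function. *)
Lemma le_bracket_H1norm a c (x : R) : 0 <= x ->
  (forall k l, (k < 2 ^ G)%N -> (l < 2 ^ G)%N -> sqfun2 G N c k l <= x ^+ 2) ->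
  bracket (hsum N a) (hsum N c) <= x * H1norm (hsum N a).
Proof.
move=> x0 cx; rewrite bracket_hsum (H1norm_hsum _ NG) -grid_meanZ.
have -> : \sum_(q <- rseq N) a q * c q * area R q =
    \sum_(q <- rseq N) (a q * c q) * grid_mean G (fun k l => (in_rect G q k l)%:R).
  by apply: eq_big_seq => q qN; rewrite -(area_grid_mean _ NG qN).
rewrite -grid_mean_sum; apply: le_grid_mean => k l kG lG; rewrite [leRHS]mulrC.
have -> : \sum_(q <- rseq N) (a q * c q) * (in_rect G q k l)%:R =
    \sum_(q <- rseq N) (a q * (in_rect G q k l)%:R) * (c q * (in_rect G q k l)%:R).
  by apply: eq_bigr => q _; rewrite mulrACA -natrM mulnb andbb.
apply: (le_trans (sum_mul_le_sqrt _ _ _)).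
have E d : \sum_(q <- rseq N) (d q * (in_rect G q k l)%:R) ^+ 2 = sqfun2 G N d k l :> R.
  by apply: eq_bigr => q _; rewrite exprMn -natrX; case: in_rect.
rewrite !E ler_wpM2l ?sqrtr_ge0// -[leRHS]ger0_norm// -sqrtr_sqr ler_wsqrtr//.
exact: cx.
Qed.

Lemma H1norm_le c (x : R) : 0 <= x ->
  (forall k l, (k < 2 ^ G)%N -> (l < 2 ^ G)%N -> sqfun2 G N c k l <= x ^+ 2) ->
  H1norm (hsum N c) <= x.
Proof.
move=> x0 cx; rewrite (H1norm_hsum _ NG) -[leRHS](grid_mean_cst G).
apply: le_grid_mean => k l kG lG; rewrite -[leRHS]ger0_norm// -sqrtr_sqr ler_wsqrtr//.
exact: cx.
Qed.

Variable freq : rect -> nat.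
Hypothesis freq_ok : forall r, r \in rseq n -> admissible W r (freq r).

Lemma blockfun_comb (x : rect -> R) : \sum_(r <- rseq n) x r *: blockfun r (freq r) =
  hsum N (fun q => \sum_(r <- rseq n) x r * (inblock W r (freq r) q)%:R).
Proof. exact: hsum_sum. Qed.

(** The square function of the blocks is that of the Haar functions composed with a
    measure preserving map. *)
Lemma H1norm_blocks (x : rect -> R) :
  H1norm (\sum_(r <- rseq n) x r *: blockfun r (freq r)) = H1norm (hsum n x).
Proof.
rewrite blockfun_comb (H1norm_hsum _ NG) (H1norm_hsum _ ltn_nG).
pose F y l := Num.sqrt (\sum_(r <- rseq n) x r ^+ 2 * (coarse_cell r y l)%:R).
transitivity (grid_mean G (fun k l => F (coarse k) l)).
  apply: eq_grid_mean => k l kG _; rewrite (sqfun2_blocks (rr := id))//.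
  - by congr Num.sqrt; apply: eq_big_seq => r rn; rewrite block_cell_coarse.
  - exact: rseq_uniq.
  - by move=> r rn; split=> //; exact: freq_ok.
rewrite grid_mean_coarse; apply: eq_grid_mean => k l kG _; congr Num.sqrt.
by apply: eq_big_seq => r rn; rewrite in_rect_coarse.
Qed.

Definition blockcoef a r : R := bracket (hsum N a) (blockfun r (freq r)) / area R r.

Lemma coarse_fibre k : \sum_(k' < 2 ^ G) (coarse k' == coarse k)%:R = 2 ^+ (G - n.+1) :> R.
Proof.
rewrite (digits_uniform W0 (fun u => (u == coarse k)%N%:R : R)); last 2 first.
- exact: leq_trans nN (ltnW NG).
- exact: ltn_nG.
rewrite (sum_pow2_div (fun u => (u == coarse k)%N%:R : R)) ?leq_subr// sumrMnl subKn ?ltn_nG//.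
have := sum_delta (fun=> 1 : R) (digits_lt W n.+1 (k %/ 2 ^ (G - n.+1 * W))).
by under eq_bigr do rewrite mulr1; move=> ->; rewrite natrX.
Qed.

Definition cellcoef a l r k : R :=
  a (dy (freq r) (k %/ 2 ^ (G - freq r)), r.2) * (block_cell W G r k l)%:R.

(** The step function whose mean over the support of the block is the coefficient is
    constant on the intervals of length $2^{-m}$. By equidistribution, its mean over
    that support is its mean over each fibre of coarse inside the support; thus
    one and the same averaging operator computes the coefficients of all blocks. *)
Lemma blockcoef_fibre a r k l : r \in rseq n ->
  blockcoef a r * (coarse_cell r (coarse k) l)%:R =
  \sum_(k' < 2 ^ G) (2 ^- (G - n.+1) * (coarse k' == coarse k)%:R) * cellcoef a l r k'.
Proof.
move=> rn; have rm := freq_ok rn.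
have [rn1 rn2] := rseq_ltG ltn_nG rn.
case: (boolP (coarse_cell r (coarse k) l)) => [kl|/negbTE kl]; last first.
  rewrite mulr0 big1// => k' _; rewrite /cellcoef block_cell_coarse//.
  by case: eqP => [->|_]; rewrite ?kl !(mulr0, mul0r).
have /andP[/eqP ke lJ] := kl.
rewrite mulr1; set g := fun u => a (dy (freq r) u, r.2).
transitivity (2 ^- (G - n.+1) * \sum_(k' < 2 ^ G) g (k' %/ 2 ^ (G - freq r))%N *
    (coarse k' == coarse k)%:R); last first.
  rewrite mulr_sumr; apply: eq_bigr => k' _; rewrite /cellcoef -/(g _) block_cell_coarse//.
  by case: eqP => [->|_]; rewrite ?kl !(mulr0, mul0r, mulr1).
set d := (n.+1 - tag r.1)%N.
have dE : (tag r.1 + d = n.+1)%N.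
  by move: rn; rewrite mem_rseq /d => /andP[h _]; rewrite subnKC// leqW.
have /andP[_ mi] := rm.
have := @digits_equidistributed R W W0 G (tag r.1) d (freq r) (coarse k) g mi.
rewrite dE ke => /(_ (leq_trans nN (ltnW NG))) e.
rewrite /blockcoef (bracket_blockfun _ rn rm).
transitivity (grid_mean G (fun k' l' => (g (k' %/ 2 ^ (G - freq r))%N *
    (digits W (tag r.1) (k' %/ 2 ^ (G - tag r.1 * W)) == tagged r.1)%N%:R) *
    (in_ivl G r.2 l')%:R) / area R r).
  by congr (_ / _); apply: eq_grid_mean => k' l' _ _; rewrite /block_cell -mulnb natrM mulrA.
rewrite grid_meanM mean_in_ivl// -e.
have GE : 2 ^+ G = 2 ^+ (G - n.+1) * (2 ^+ tag r.1 * 2 ^+ d) :> R.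
  by rewrite -!exprD dE subnK ?ltn_nG.
rewrite GE /area [dlen r.1]/dlen.
set S := \sum_(k' < _) _.
have J0 := dlen_gt0 R r.2; move: (dlen r.2) J0 => J0 J0p.
by field; rewrite !expf_neq0// gt_eqF.
Qed.

Lemma sum_cellcoef_sqr a k l : (k < 2 ^ G)%N ->
  \sum_(r <- rseq n) cellcoef a l r k ^+ 2 <= sqfun2 G N a k l.
Proof.
move=> kG; rewrite /sqfun2.
have -> : \sum_(r <- rseq n) cellcoef a l r k ^+ 2 = \sum_(r <- rseq n)
    \sum_(q <- rseq N) a q ^+ 2 * (inblock W r (freq r) q && in_rect G q k l)%:R.
  apply: eq_big_seq => r rn; have rm := freq_ok rn.
  by rewrite (sum_inblock (fun q => a q ^+ 2) l rn rm kG) exprMn -natrX; case: block_cell.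
rewrite exchange_big; apply: ler_sum => q _ /=; rewrite -mulr_sumr.
apply: ler_wpM2l; first exact: sqr_ge0.
under eq_bigr do rewrite -mulnb natrM.
rewrite -mulr_suml -[leRHS]mul1r; apply: ler_wpM2r => //.
apply: sum_disjoint_le1; first exact: rseq_uniq.
move=> r r' rn rn' b b'; have rm := freq_ok rn; have rm' := freq_ok rn'.
by have [] := inblock_inj rm rm' b b'.
Qed.

(** All the coefficients are averages over the same fibres, so convexity of the
    Euclidean norm applies at each point, with no loss in the number of blocks. *)
Lemma H1norm_blockcoef a : H1norm (hsum n (blockcoef a)) <= H1norm (hsum N a).
Proof.
rewrite (H1norm_hsum _ NG) (H1norm_hsum _ ltn_nG).
pose F y l := Num.sqrt (\sum_(r <- rseq n) (blockcoef a r * (coarse_cell r y l)%:R) ^+ 2).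
have -> : grid_mean G (fun k l => Num.sqrt (sqfun2 G n (blockcoef a) k l)) =
    grid_mean G (fun k l => F (coarse k) l).
  rewrite grid_mean_coarse; apply: eq_grid_mean => k l _ _; congr Num.sqrt.
  by apply: eq_big_seq => r rn; rewrite in_rect_coarse// [RHS]exprMn -natrX; case: coarse_cell.
pose V k l := Num.sqrt (\sum_(r <- rseq n) cellcoef a l r k ^+ 2).
apply: (@le_trans _ _ (grid_mean G V)); last first.
  apply: le_grid_mean => k l kG _; rewrite ler_wsqrtr//; exact: sum_cellcoef_sqr.
have h0 m : 0 <= 2 ^- m :> R by rewrite invr_ge0 exprn_ge0.
rewrite /grid_mean; apply: ler_wpM2l => //; apply: ler_sum => l _; apply: ler_wpM2l => //.
apply: (@le_trans _ _ (\sum_(k < 2 ^ G) \sum_(k' < 2 ^ G)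
    (2 ^- (G - n.+1) * (coarse k' == coarse k)%:R) * V k' l)).
  apply: ler_sum => k _; rewrite /F.
  under eq_big_seq => r rn do rewrite (blockcoef_fibre _ _ _ rn).
  apply: (@sqrt_sum_sqr_convex R _ _ (rseq n) (index_enum 'I_(2 ^ G))
    (fun k' => 2 ^- (G - n.+1) * (coarse k' == coarse k)%:R) (fun r k' => cellcoef a l r k')).
  by move=> k'; rewrite mulr_ge0.
rewrite exchange_big; apply: ler_sum => k' _ /=.
rewrite -mulr_suml -mulr_sumr.
under eq_bigr do rewrite eq_sym.
by rewrite coarse_fibre mulVf ?mul1r// expf_neq0.
Qed.

End blocks.

(** * Linear operators on finite Haar sums *)

Section operators.
Variable R : realType.
Implicit Types (f g : R * R -> R).

Lemma bracketC f g : bracket f g = bracket g f.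
Proof. by congr int2; apply/funext => p; rewrite mulrC. Qed.

Lemma bracket_sumr N (T : Type) (s : seq T) (a : rect -> R) (x : T -> R) (A : T -> rect -> R) :
  bracket (hsum N a) (\sum_(i <- s) x i *: hsum N (A i))
  = \sum_(i <- s) x i * bracket (hsum N a) (hsum N (A i)).
Proof.
rewrite hsum_sum bracket_hsum; under [RHS]eq_bigr do rewrite bracket_hsum mulr_sumr.
rewrite exchange_big; apply: eq_bigr => r _; rewrite mulr_sumr mulr_suml.
by apply: eq_bigr => i _; ring.
Qed.

Lemma H1norm_ge0 N (a : rect -> R) : 0 <= H1norm (hsum N a).
Proof.
rewrite (H1norm_hsum _ (ltnSn N)) -[leLHS](grid_mean_cst N.+1).
by apply: le_grid_mean => k l _ _; exact: sqrtr_ge0.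
Qed.

Lemma H1normZ N (x : R) (a : rect -> R) :
  H1norm (x *: hsum N a) = `|x| * H1norm (hsum N a).
Proof.
rewrite hsumZ !(H1norm_hsum _ (ltnSn N)) -grid_meanZ; apply: eq_grid_mean => k l _ _.
rewrite -sqrtr_sqr -sqrtrM ?sqr_ge0//; congr Num.sqrt.
by rewrite /sqfun2 mulr_sumr; apply: eq_bigr => r _; rewrite exprMn -mulrA.
Qed.

Lemma H1n_lin N (x : R) f g : H1n N f -> H1n N g -> H1n N (x *: f + g).
Proof. by move=> /H1nP[a ->] /H1nP[c ->]; apply/H1nP; eexists; exact: hsum_lin. Qed.

Lemma H1n0 N : H1n N (0 : R * R -> R).
Proof. by apply/H1nP; exists (fun=> 0); rewrite hsum0. Qed.

Lemma linear_on0 (V U : lmodType R) (D : set V) (T : V -> U) : D 0 -> linear_on D T -> T 0 = 0.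
Proof.
move=> D0 /(_ 1 0 0 D0 D0); rewrite !scale1r addr0 => e.
by apply: (addrI (T 0)); rewrite addr0 -e.
Qed.

Lemma linear_on_sum (V U : lmodType R) (D : set V) (T : V -> U) (I : eqType) (s : seq I)
    (x : I -> R) (v : I -> V) : D 0 ->
  (forall y u w, D u -> D w -> D (y *: u + w)) -> linear_on D T ->
  (forall i, i \in s -> D (v i)) ->
  D (\sum_(i <- s) x i *: v i) /\
  T (\sum_(i <- s) x i *: v i) = \sum_(i <- s) x i *: T (v i).
Proof.
move=> D0 Dlin Tlin; elim: s => [|i s IH] Dv.
  by rewrite !big_nil; split=> //; exact: linear_on0 Tlin.
have [|Ds Ts] := IH; first by move=> j js; apply: Dv; rewrite inE js orbT.
have Di := Dv i (mem_head _ _).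
by rewrite !big_cons; split; [exact: Dlin | rewrite Tlin// Ts].
Qed.

Lemma opnorm_bound N (T : (R * R -> R) -> R * R -> R) (M x : R) f :
  linear_on (H1n N) T -> (forall f, H1n N f -> H1n N (T f)) ->
  (opnorm H1norm H1norm (H1n N) T <= M%:E)%E ->
  H1n N f -> 0 < x -> H1norm f <= x -> H1norm (T f) <= M * x.
Proof.
move=> Tlin TN TM fN x0 fx; have [a fE] := (H1nP N f).1 fN.
have [c TfE] := (H1nP N (T f)).1 (TN _ fN).
have gN : H1n N (x^-1 *: f) by rewrite -[_ *: f]addr0; apply: H1n_lin => //; exact: H1n0.
have Tg : T (x^-1 *: f) = x^-1 *: T f.
  rewrite -[x^-1 *: f]addr0 Tlin//; last exact: H1n0.
  by rewrite (linear_on0 (H1n0 N) Tlin) addr0.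
have : ((H1norm (T (x^-1 *: f)))%:E <= M%:E)%E.
  apply: le_trans TM; apply: ereal_sup_ubound; exists (x^-1 *: f) => //; split=> //.
  by rewrite fE H1normZ -fE gtr0_norm ?invr_gt0// ler_pdivrMl// mulr1.
rewrite lee_fin Tg TfE H1normZ gtr0_norm ?invr_gt0//.
by rewrite ler_pdivrMl// mulrC.
Qed.

End operators.

(** * Choice of the frequencies *)

Section selection.
Variables (R : realType) (W n N : nat).
Hypotheses (W0 : (0 < W)%N) (nN : (n.+1 * W <= N)%N).
Let NG := ltnSn N.
Local Notation blockfun := (@blockfun R W N).

Lemma blockfun_H1n r m : H1n N (blockfun r m).
Proof. by apply/H1nP; eexists. Qed.

Definition freqs (r : rect) := iota (tag r.1 * W) W.

Lemma freqs_ok r m : m \in freqs r -> admissible W r m.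
Proof. by rewrite mem_iota /admissible mulSnr. Qed.

Lemma sqfun2_freqs r (x : nat -> R) k l : r \in rseq n -> (forall m, x m ^+ 2 <= 1) ->
  (k < 2 ^ N.+1)%N ->
  sqfun2 N.+1 N (fun q => \sum_(m <- freqs r) x m * (inblock W r m q)%:R) k l
  <= Num.sqrt W%:R ^+ 2.
Proof.
move=> rn x1 kG; rewrite sqr_sqrtr ?ler0n//.
rewrite (sqfun2_blocks W0 nN NG (rr := fun=> r) (freq := id))//.
- apply: (@le_trans _ _ (\sum_(m <- freqs r) 1)); last first.
    by rewrite big_const_seq count_predT iter_addr_0 size_iota.
  apply: ler_sum => m _; by case: block_cell; rewrite ?mulr1 ?mulr0.
- exact: iota_uniq.
- by move=> m mr; split=> //; exact: freqs_ok.
Qed.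

Lemma sgr_sqr_le1 (x : R) : Num.sg x ^+ 2 <= 1.
Proof. by rewrite sqr_sg; case: eqP. Qed.

(** Test f against the signed sum of the candidates: its square function is at most
    $\sqrt W$, because at each point every candidate contributes at most 1. *)
Lemma sum_bracket_freqs r (a : rect -> R) : r \in rseq n ->
  \sum_(m <- freqs r) `|bracket (hsum N a) (blockfun r m)|
  <= Num.sqrt W%:R * H1norm (hsum N a).
Proof.
move=> rn; pose x m := Num.sg (bracket (hsum N a) (blockfun r m)).
have -> : \sum_(m <- freqs r) `|bracket (hsum N a) (blockfun r m)|
    = bracket (hsum N a) (\sum_(m <- freqs r) x m *: blockfun r m).
  by rewrite bracket_sumr; apply: eq_bigr => m _; rewrite normrEsg.
rewrite hsum_sum; apply: (le_bracket_H1norm NG); first exact: sqrtr_ge0.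
by move=> k l kG _; apply: sqfun2_freqs => // m; exact: sgr_sqr_le1.
Qed.

Lemma sqfun2_blockfun r m k l : r \in rseq n -> admissible W r m -> (k < 2 ^ N.+1)%N ->
  sqfun2 N.+1 N (fun q => (inblock W r m q)%:R : R) k l <= 1 ^+ 2.
Proof.
move=> rn rm kG; rewrite /sqfun2.
have -> : \sum_(q <- rseq N) (inblock W r m q)%:R ^+ 2 * (in_rect N.+1 q k l)%:R
   = \sum_(q <- rseq N) 1 * (inblock W r m q && in_rect N.+1 q k l)%:R :> R.
  by apply: eq_bigr => q _; rewrite mul1r -natrX -natrM; case: inblock; case: in_rect.
rewrite (sum_inblock W0 nN NG (fun=> 1 : R) l rn rm kG) mul1r.
by case: block_cell; rewrite ?expr1n.
Qed.

Lemma H1norm_blockfun r m : r \in rseq n -> admissible W r m -> H1norm (blockfun r m) <= 1.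
Proof.
by move=> rn rm; apply: (H1norm_le NG) => // k l kG _; exact: sqfun2_blockfun.
Qed.

Lemma norm_bracket_blockfun r m f : r \in rseq n -> admissible W r m -> H1n N f ->
  `|bracket f (blockfun r m)| <= H1norm f.
Proof.
move=> rn rm /H1nP[a ->]; rewrite ler_norml; apply/andP; split; last first.
  rewrite -[leRHS]mul1r; apply: (le_bracket_H1norm NG) => // k l kG _; exact: sqfun2_blockfun.
rewrite lerNl -mulN1r -[X in _ <= X]mul1r.
have -> : -1 * bracket (hsum N a) (blockfun r m)
    = bracket (hsum N a) (hsum N (fun q => -1 * (inblock W r m q)%:R)).
  by rewrite !bracket_hsum mulr_sumr; apply: eq_bigr => q _; ring.
apply: (le_bracket_H1norm NG) => // k l kG _.
have -> : sqfun2 N.+1 N (fun q => -1 * (inblock W r m q)%:R) k l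
    = sqfun2 N.+1 N (fun q => (inblock W r m q)%:R) k l :> R.
  by apply: eq_bigr => q _; rewrite mulN1r sqrrN.
exact: sqfun2_blockfun.
Qed.

Section operator.
Variables (T : (R * R -> R) -> (R * R -> R)) (M : R).
Hypotheses (M0 : 0 < M) (Tlin : linear_on (H1n N) T)
  (TN : forall f, H1n N f -> H1n N (T f))
  (TM : (opnorm H1norm H1norm (H1n N) T <= M%:E)%E).

(** By linearity the sum is one bracket with T of the signed sum of the candidates,
    which has norm at most $\sqrt W$. *)
Lemma sum_bracket_T_freqs r r' m' : r \in rseq n -> r' \in rseq n -> admissible W r' m' ->
  \sum_(m <- freqs r) `|bracket (T (blockfun r m)) (blockfun r' m')| <= M * Num.sqrt W%:R.
Proof.
move=> rn rn' rm'; pose x m := Num.sg (bracket (T (blockfun r m)) (blockfun r' m')).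
set f := \sum_(m <- freqs r) x m *: blockfun r m.
have [fN Tf] : H1n N f /\ T f = \sum_(m <- freqs r) x m *: T (blockfun r m).
  apply: (linear_on_sum x (v := blockfun r)) => //; first exact: H1n0.
    by move=> *; exact: H1n_lin.
  by move=> m _; exact: blockfun_H1n.
have W1 : 0 < Num.sqrt W%:R :> R by rewrite sqrtr_gt0 ltr0n.
apply: (@le_trans _ _ (H1norm (T f))); last first.
  apply: (opnorm_bound Tlin TN TM) => //.
  rewrite /f hsum_sum; apply: (H1norm_le NG); first exact: sqrtr_ge0.
  by move=> k l kG _; apply: sqfun2_freqs => // m; exact: sgr_sqr_le1.
apply: le_trans (norm_bracket_blockfun rn' rm' (TN fN)); apply: le_trans (ler_norm _).
rewrite Tf bracketC.
have TbN m : {a | T (blockfun r m) = hsum N a}.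
  by apply: cid; apply/H1nP/TN/blockfun_H1n.
under [X in _ <= bracket _ X]eq_bigr => m _ do rewrite (projT2 (TbN m)).
rewrite bracket_sumr le_eqVlt; apply/orP; left; apply/eqP; apply: eq_bigr => m _.
by rewrite -(projT2 (TbN m)) [in RHS]bracketC -normrEsg.
Qed.

Lemma exists_le_avg (s : seq nat) (X : nat -> R) (d : R) : (0 < size s)%N ->
  \sum_(m <- s) X m <= (size s)%:R * d -> exists2 m, m \in s & X m <= d.
Proof.
move=> s0 Xd; apply: contrapT => /forall2NP H.
have lt m : m \in s -> d < X m.
  by move=> ms; case: (H m) => // /negP; rewrite -ltNge.
move: Xd; rewrite mulr_natl -iter_addr_0 -(count_predT s) -big_const_seq.
case: s s0 lt {H} => // m s _ lt; rewrite !big_cons.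
suff le : \sum_(j <- s) d <= \sum_(j <- s) X j.
  by have := lt m (mem_head _ _); rewrite /=; lra.
by rewrite big_seq [leRHS]big_seq; apply: ler_sum => j js; apply/ltW/lt; rewrite inE js orbT.
Qed.

Lemma addends_le (x y z d : R) :
  x + y + z <= d -> 0 <= z -> 0 <= x -> 0 <= y -> x <= d /\ y <= d.
Proof. by move=> *; split; lra. Qed.

(** The rectangles are treated one at a time. For a new one, the interactions with all
    the previous blocks, summed over the W candidate frequencies, are of order
    $\sqrt W$, hence some candidate makes all of them of order $1/\sqrt W$. *)
Lemma select_freqs (K : nat) (d : R) (s : seq rect) :
  2 * K%:R * (M * Num.sqrt W%:R) <= W%:R * d -> (size s <= K)%N -> uniq s ->
  {subset s <= rseq n} ->
  exists freq : rect -> nat, (forall r, r \in s -> admissible W r (freq r)) /\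
    forall r r', r \in s -> r' \in s -> r != r' ->
      `|bracket (T (blockfun r (freq r))) (blockfun r' (freq r'))| <= d.
Proof.
move=> Kd; elim: s => [|r s IH] /=; first by exists (fun=> 0%N).
move=> sK /andP[rs us] sn.
have rn : r \in rseq n by apply: sn; rewrite mem_head.
have sn' : {subset s <= rseq n} by move=> q qs; apply: sn; rewrite inE qs orbT.
have [freq [freq_ok freq_small]] := IH (ltnW sK) us sn'.
pose X m := \sum_(q <- s) (`|bracket (T (blockfun q (freq q))) (blockfun r m)| +
                           `|bracket (T (blockfun r m)) (blockfun q (freq q))|).
have [m mr Xm] : exists2 m, m \in freqs r & X m <= d.
  apply: exists_le_avg; rewrite size_iota//.
  apply: le_trans Kd; rewrite /X exchange_big.
  apply: (@le_trans _ _ (\sum_(q <- s) 2 * (M * Num.sqrt W%:R))).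
    rewrite big_seq [leRHS]big_seq; apply: ler_sum => q qs; rewrite big_split mulr_natl mulr2n.
    have qok := freq_ok q qs; have qn := sn' q qs.
    apply: lerD; last exact: sum_bracket_T_freqs.
    have [a TE] := (H1nP N _).1 (TN (blockfun_H1n q (freq q))).
    rewrite TE; apply: (le_trans (sum_bracket_freqs _ rn)).
    rewrite -TE mulrC; apply: ler_wpM2r; first exact: sqrtr_ge0.
    rewrite -[M]mulr1; apply: (opnorm_bound Tlin TN TM) => //; first exact: blockfun_H1n.
    exact: H1norm_blockfun.
  rewrite big_const_seq count_predT iter_addr_0 -[_ *+ size s]mulr_natl.
  rewrite mulrA [_ * 2]mulrC; apply: ler_wpM2r.
    by rewrite mulr_ge0 ?sqrtr_ge0// ltW.
  by rewrite ler_wpM2l// ler_nat ltnW.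
have Xq q : q \in s -> `|bracket (T (blockfun q (freq q))) (blockfun r m)| <= d /\
                       `|bracket (T (blockfun r m)) (blockfun q (freq q))| <= d.
  move=> qs; move: Xm; rewrite /X (big_rem q)//= => Xm.
  have S0 : 0 <= \sum_(q0 <- rem q s) (`|bracket (T (blockfun q0 (freq q0))) (blockfun r m)| +
                           `|bracket (T (blockfun r m)) (blockfun q0 (freq q0))|).
    by apply: sumr_ge0 => *; rewrite addr_ge0.
  exact: addends_le Xm S0 (normr_ge0 _) (normr_ge0 _).
pose freq' q := if q == r then m else freq q.
have freq'r : freq' r = m by rewrite /freq' eqxx.
have freq's q : q \in s -> freq' q = freq q.
  by rewrite /freq' => qs; case: eqP => // e; rewrite e (negbTE rs) in qs.
exists freq'; split=> [q|q q'].
  rewrite inE => /predU1P[->|qs]; first by rewrite freq'r; exact: freqs_ok.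
  by rewrite freq's//; exact: freq_ok.
rewrite !inE => /predU1P[->|qs] /predU1P[->|qs'] qq'.
- by rewrite eqxx in qq'.
- by rewrite freq'r freq's//; have [] := Xq q' qs'.
- by rewrite freq'r freq's//; have [] := Xq q qs.
- by rewrite !freq's//; exact: freq_small.
Qed.

End operator.
End selection.

(** * The bracket on the Haar span *)

Section span.
Variable R : realType.
Implicit Types (u v g : R * R -> R).

Lemma ler_addgt0_scale (x y K : R) : 0 <= K ->
  (forall e, 0 < e -> x <= y + K * e) -> x <= y.
Proof.
move=> K0 H; apply/ler_addgt0Pr => e e0.
have K1 : 0 < K + 1 by rewrite ltr_wpDl.
apply: (le_trans (H (e / (K + 1)) _)); first by rewrite divr_gt0.
rewrite lerD2l mulrCA ger_pMr// ler_pdivrMr// mul1r lerDl; exact: ler01.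
Qed.

Lemma lin_defect (P x p q U V : R) :
  P - (x * p + q) = - (x * U + V - P) + (x * (U - p) + (V - q)).
Proof. by ring. Qed.

Lemma haar_span_wide u : haar_span u ->
  exists N0, forall N, (N0 <= N)%N -> exists a, u = hsum N a.
Proof.
move=> us; have [N0 [a [_ ->]]] := haar_spanP 0 us; exists N0 => N NN.
by eexists; exact: hsum_widen.
Qed.

Lemma haar_span0 : haar_span (0 : R * R -> R).
Proof. by rewrite -(hsum0 R 0); exact: hsum_span. Qed.

Lemma haar_span_lin (x : R) u v : haar_span u -> haar_span v -> haar_span (x *: u + v).
Proof.
move=> /haar_span_wide[N1 h1] /haar_span_wide[N2 h2].
have [a ->] := h1 _ (leq_maxl N1 N2); have [c ->] := h2 _ (leq_maxr N1 N2).
by rewrite hsum_lin; exact: hsum_span.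
Qed.

Lemma haar_spanZ (x : R) u : haar_span u -> haar_span (x *: u).
Proof. by move=> us; rewrite -[_ *: _]addr0; apply: haar_span_lin => //; exact: haar_span0. Qed.

Lemma bracket_lin g (x : R) u v : haar_span g -> haar_span u -> haar_span v ->
  bracket (x *: u + v) g = x * bracket u g + bracket v g.
Proof.
move=> /haar_span_wide[N0 h0] /haar_span_wide[N1 h1] /haar_span_wide[N2 h2].
set N := maxn N0 (maxn N1 N2).
have [a ->] : exists a, g = hsum N a by apply: h0; rewrite /N; lia.
have [c ->] : exists a, u = hsum N a by apply: h1; rewrite /N; lia.
have [d ->] : exists a, v = hsum N a by apply: h2; rewrite /N; lia.
rewrite hsum_lin !bracket_hsum mulr_sumr -big_split; apply: eq_bigr => r _ /=.
by ring.
Qed.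

Lemma bracketZ g (x : R) u : haar_span g -> haar_span u ->
  bracket (x *: u) g = x * bracket u g.
Proof.
move=> gs us; have h0 := haar_span0.
have := bracket_lin (-1) gs h0 h0; rewrite scaler0 addr0 mulN1r addNr => b0.
by have := bracket_lin x gs us h0; rewrite addr0 b0 addr0.
Qed.

Lemma bracket_suml g (s : seq rect) (x : rect -> R) (b : rect -> R * R -> R) :
  haar_span g -> (forall r, r \in s -> haar_span (b r)) ->
  bracket (\sum_(r <- s) x r *: b r) g = \sum_(r <- s) x r * bracket (b r) g.
Proof.
move=> gs bs.
apply: (@linear_on_sum R _ R^o haar_span (fun u => bracket u g) _ s x b haar_span0
  haar_span_lin _ bs).2.
by move=> y u v us vs; exact: bracket_lin.
Qed.

Lemma haar_span_sum (s : seq rect) (x : rect -> R) (b : rect -> R * R -> R) :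
  (forall r, r \in s -> haar_span (b r)) -> haar_span (\sum_(r <- s) x r *: b r).
Proof.
move=> bs; rewrite big_seq; elim/big_ind: _ => [|u v us vs|r rs].
- exact: haar_span0.
- by rewrite -[u]scale1r; exact: haar_span_lin.
- by apply: haar_spanZ; exact: bs.
Qed.

End span.

(** * Extension to the completion *)

Section completion.
Variables (R : realType) (H : completeNormedModType R) (iota : (R * R -> R) -> H).
Hypothesis Hc : is_completion iota.
Implicit Types (f h : H) (u v g : R * R -> R).

Lemma iota_lin (x : R) u v : haar_span u -> haar_span v ->
  iota (x *: u + v) = x *: iota u + iota v.
Proof. by case: Hc => L _ _; exact: L. Qed.

Lemma iota_norm u : haar_span u -> `|iota u| = H1norm u.
Proof. by case: Hc => _ L _; exact: L. Qed.

Lemma iota0 : iota 0 = 0.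
Proof. by case: Hc => L _ _; exact: linear_on0 (@haar_span0 R) L. Qed.

Lemma iotaZ (x : R) u : haar_span u -> iota (x *: u) = x *: iota u.
Proof.
by move=> us; rewrite -[x *: u]addr0 iota_lin ?iota0 ?addr0//; exact: haar_span0.
Qed.

Lemma iota_sum (s : seq rect) (x : rect -> R) (b : rect -> R * R -> R) :
  (forall r, r \in s -> haar_span (b r)) ->
  iota (\sum_(r <- s) x r *: b r) = \sum_(r <- s) x r *: iota (b r).
Proof.
move=> bs; case: Hc => L _ _.
exact: (@linear_on_sum R _ _ haar_span iota _ s x b (@haar_span0 R) (@haar_span_lin R) L bs).2.
Qed.

Lemma iota_dense f (e : R) : 0 < e -> exists2 u, haar_span u & `|f - iota u| < e.
Proof.
move=> e0; case: Hc => _ _ /(_ (ball f e)) D.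
have [||h [/= fu [u us uh]]] := D.
- by exists f; exact: ballxx.
- exact: ball_open.
- by exists u => //; move: fu; rewrite -ball_normE /= uh.
Qed.

Definition bounded_on_span g (C : R) :=
  0 <= C /\ forall u, haar_span u -> `|bracket u g| <= C * H1norm u.

Section functional.
Variables (g : R * R -> R) (C : R).
Hypotheses (gs : haar_span g) (gC : bounded_on_span g C).

Lemma bracket_dist u v : haar_span u -> haar_span v ->
  `|bracket u g - bracket v g| <= C * `|iota u - iota v|.
Proof.
move=> us vs; have [_ B] := gC.
have ws : haar_span (-1 *: v + u) by exact: haar_span_lin.
have -> : bracket u g - bracket v g = bracket (-1 *: v + u) g.
  by rewrite bracket_lin// mulN1r addrC.
by apply: (le_trans (B _ ws)); rewrite -iota_norm// iota_lin// scaleN1r addrC.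
Qed.

(** The values at span elements close to f form a Cauchy filter, and the Lipschitz bound
    passes to the limit. *)
Lemma bracket_ext_dist f u : haar_span u ->
  `|bracket u g - bracket_ext iota f g| <= C * `|f - iota u|.
Proof.
move=> us; have [C0 _] := gC.
pose F := filter_from (nbhs f) (fun B => (haar_span : set (R * R -> R)) `&` iota @^-1` B).
have FF : ProperFilter F.
  apply: filter_from_proper.
    apply: filter_from_filter; first by exists setT; exact: filterT.
    move=> A B fA fB; exists (A `&` B); first exact: filterI.
    by move=> w [ws [wA wB]].
  move=> B /nbhs_ballP[e /= e0 eB]; have [w ws we] := iota_dense f e0.
  by exists w; split=> //; apply: eB; rewrite -ball_normE.
have Fball e : 0 < e -> F [set w | haar_span w /\ `|f - iota w| < e].
  move=> e0; exists (ball f e); first exact: nbhsx_ballx.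
  by move=> w [ws]; rewrite -ball_normE.
have cF : cvg ((fun w => bracket w g) @ F).
  apply: cauchy_cvg; apply: cauchy_exP => e e0.
  have C1 : 0 < C + 1 by rewrite ltr_wpDl.
  have e1 : 0 < e / (2 * (C + 1)) by rewrite divr_gt0// mulr_gt0.
  have [w ws we] := iota_dense f e1; exists (bracket w g).
  apply: filterS (Fball _ e1) => v [vs ve]; rewrite /= -ball_normE /=.
  apply: (le_lt_trans (bracket_dist ws vs)).
  have wv : `|iota w - iota v| < e / (C + 1).
    have -> : e / (C + 1) = e / (2 * (C + 1)) + e / (2 * (C + 1)).
      by field; rewrite gt_eqF.
    apply: le_lt_trans (ltrD we ve); rewrite (distrC f (iota w)).
    exact: ler_distD.
  apply: (@le_lt_trans _ _ (C * (e / (C + 1)))); first by rewrite ler_wpM2l// ltW.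
  by rewrite mulrCA gtr_pMr// ltr_pdivrMr// mul1r ltrDl.
set l := bracket_ext iota f g.
apply: (@ler_addgt0_scale _ _ _ (C + 1)); first by rewrite addr_ge0.
move=> e e0.
have cl : (fun w => bracket w g) @ F --> l by exact: cF.
have near_l : F [set w | `|l - bracket w g| < e].
  by move/pseudometric_normed_Zmodule.cvgrPdist_lt: cl => /(_ _ e0).
have [w [/= wl [ws we]]] := filter_ex (filterI near_l (Fball e e0)).
apply: (le_trans (ler_distD (bracket w g) _ _)).
have d1 := bracket_dist us ws.
have d2 : C * `|iota u - iota w| <= C * (`|f - iota u| + e).
  apply: ler_wpM2l => //; apply: (le_trans (ler_distD f _ _)).
  by rewrite distrC lerD2l ltW.
rewrite distrC in wl; apply: (le_trans (lerD (le_trans d1 d2) (ltW wl))).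
by rewrite mulrDr mulrDl mul1r addrA.
Qed.

Lemma bracket_ext_iota u : haar_span u -> bracket_ext iota (iota u) g = bracket u g.
Proof.
move=> us; have := bracket_ext_dist (iota u) us.
by rewrite subrr normr0 mulr0 normr_le0 subr_eq0 => /eqP.
Qed.

Lemma bracket_ext_norm f : `|bracket_ext iota f g| <= C * `|f|.
Proof.
have := bracket_ext_dist f (@haar_span0 R).
have -> : bracket 0 g = 0.
  by have := bracketZ 0 gs (@haar_span0 R); rewrite scale0r mul0r.
by rewrite iota0 subr0 sub0r normrN.
Qed.

Lemma bracket_ext_lin (x : R) f h :
  bracket_ext iota (x *: f + h) g = x * bracket_ext iota f g + bracket_ext iota h g.
Proof.
have [C0 _] := gC.
apply/eqP; rewrite -subr_eq0 -normr_le0.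
apply: (@ler_addgt0_scale _ _ _ (2 * C * (`|x| + 1))).
  by rewrite !mulr_ge0// addr_ge0.
move=> e e0; have [u us ue] := iota_dense f e0; have [v vs ve] := iota_dense h e0.
have := bracket_ext_dist (x *: f + h) (haar_span_lin x us vs).
rewrite iota_lin// bracket_lin//.
have -> : x *: f + h - (x *: iota u + iota v) = x *: (f - iota u) + (h - iota v).
  by rewrite scalerBr opprD addrACA.
have nrm : `|x *: (f - iota u) + (h - iota v)| <= (`|x| + 1) * e.
  apply: (le_trans (ler_normD _ _)); rewrite normrZ mulrDl mul1r lerD//; last exact: ltW.
  by rewrite ler_wpM2l// ltW.
move=> /le_trans/(_ (ler_wpM2l C0 nrm)) d1.
have d2 : `|bracket u g - bracket_ext iota f g| <= C * e.
  by apply: (le_trans (bracket_ext_dist f us)); rewrite ler_wpM2l// ltW.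
have d3 : `|bracket v g - bracket_ext iota h g| <= C * e.
  by apply: (le_trans (bracket_ext_dist h vs)); rewrite ler_wpM2l// ltW.
set P := bracket_ext iota (x *: f + h) g in d1 *.
set p := bracket_ext iota f g in d2 *; set q := bracket_ext iota h g in d3 *.
rewrite (lin_defect P x p q (bracket u g) (bracket v g)).
apply: (le_trans (ler_normD _ _)); rewrite normrN.
have d4 : `|x * (bracket u g - p) + (bracket v g - q)| <= `|x| * (C * e) + C * e.
  by apply: (le_trans (ler_normD _ _)); rewrite normrM lerD// ler_wpM2l.
rewrite add0r; apply: (le_trans (lerD d1 d4)).
by rewrite le_eqVlt; apply/predU1P; left; ring.
Qed.

End functional.

Lemma bounded_on_spanZ g (C x : R) : haar_span g -> bounded_on_span g C ->
  bounded_on_span (x *: g) (`|x| * C).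
Proof.
move=> gs [C0 B]; split=> [|u us]; first by rewrite mulr_ge0.
by rewrite bracketC bracketZ// normrM bracketC -mulrA ler_wpM2l// B.
Qed.

Lemma bracket_extZ g (C x : R) f : haar_span g -> bounded_on_span g C ->
  bracket_ext iota f (x *: g) = x * bracket_ext iota f g.
Proof.
move=> gs gC; have [C0 _] := gC; have gC' := bounded_on_spanZ x gs gC.
have xgs := haar_spanZ x gs.
apply/eqP; rewrite -subr_eq0 -normr_le0.
apply: (@ler_addgt0_scale _ _ _ (2 * (`|x| * C))); first by rewrite !mulr_ge0.
move=> e e0; have [u us ue] := iota_dense f e0; rewrite add0r.
have d1 := bracket_ext_dist xgs gC' f us.
have d2 := bracket_ext_dist gs gC f us.
have uE : bracket u (x *: g) = x * bracket u g.
  by rewrite bracketC (bracketZ x us gs); congr (_ * _); exact: bracketC.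
rewrite uE in d1.
set P := bracket_ext iota f (x *: g) in d1 *; set p := bracket_ext iota f g in d2 *.
have := lin_defect P x p 0 (bracket u g) 0; rewrite !addr0 subrr addr0 => ->.
apply: (le_trans (ler_normD _ _)); rewrite normrN normrM.
have xC : 0 <= `|x| * C by rewrite mulr_ge0.
have d3 : `|x| * C * `|f - iota u| <= `|x| * C * e by rewrite ler_wpM2l// ltW.
have d4 : `|x| * `|bracket u g - p| <= `|x| * (C * `|f - iota u|) by rewrite ler_wpM2l.
rewrite mulrA in d4; apply: (le_trans (lerD (le_trans d1 d3) (le_trans d4 d3))).
by rewrite le_eqVlt; apply/predU1P; left; ring.
Qed.

Section projection.
Variables (s : seq rect) (b : rect -> R * R -> R) (A : rect -> R).
Hypotheses (us : uniq s) (A0 : forall r, r \in s -> 0 < A r)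
  (bs : forall r, r \in s -> haar_span (b r))
  (bb : forall r, r \in s -> bracket (b r) (b r) = A r)
  (borth : {in s &, forall r r', r != r' -> bracket (b r) (b r') = 0})
  (bbd : forall r, r \in s -> bounded_on_span (b r) 1)
  (contr : forall u, haar_span u ->
     H1norm (\sum_(r <- s) (bracket u (b r) / A r) *: b r) <= H1norm u).

Definition ortho_proj f : H := \sum_(r <- s)
  bracket_ext iota f ((norm2 (b r))^-1 *: b r) *: iota ((norm2 (b r))^-1 *: b r).

Let spanb : set (R * R -> R) := lspan (b @` [set` s]).

Lemma norm2_sqr (g : R * R -> R) : 0 <= bracket g g -> norm2 g ^+ 2 = bracket g g.
Proof.
have -> : norm2 g = Num.sqrt (bracket g g).
  by congr (Num.sqrt (int2 _)); apply/funext => p; rewrite expr2.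
exact: sqr_sqrtr.
Qed.

(** The two normalizing factors combine to the inverse of the squared norm. *)
Lemma ortho_projE f : ortho_proj f = \sum_(r <- s) (bracket_ext iota f (b r) / A r) *: iota (b r).
Proof.
rewrite /ortho_proj; apply: eq_big_seq => r rs.
rewrite (bracket_extZ _ _ (bs rs) (bbd rs)) (iotaZ _ (bs rs)) scalerA; congr (_ *: _).
have <- : norm2 (b r) ^+ 2 = A r by rewrite norm2_sqr bb// ltW// A0.
by rewrite mulrAC -expr2 exprVn mulrC.
Qed.

Lemma ortho_proj_linear : linear ortho_proj.
Proof.
move=> x f h; rewrite !ortho_projE scaler_sumr -big_split; apply: eq_big_seq => r rs /=.
by rewrite (bracket_ext_lin (bs rs) (bbd rs)) scalerA -scalerDl mulrDl mulrA.
Qed.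

Lemma ortho_proj_iota u : haar_span u ->
  ortho_proj (iota u) = iota (\sum_(r <- s) (bracket u (b r) / A r) *: b r).
Proof.
move=> us'; rewrite iota_sum// ortho_projE; apply: eq_big_seq => r rs.
by rewrite (bracket_ext_iota (bs rs) (bbd rs)).
Qed.

Lemma bracket_comb (x : rect -> R) r : r \in s ->
  bracket (\sum_(q <- s) x q *: b q) (b r) = x r * A r.
Proof.
move=> rs; rewrite (bracket_suml x (bs rs) bs) (bigD1_seq r)//= bb// big_seq_cond big1 ?addr0//.
by move=> q /andP[qs qr]; rewrite borth// mulr0.
Qed.

Lemma ortho_proj_comb (x : rect -> R) :
  ortho_proj (iota (\sum_(q <- s) x q *: b q)) = iota (\sum_(q <- s) x q *: b q).
Proof.
rewrite ortho_proj_iota; last exact: haar_span_sum.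
congr iota; apply: eq_big_seq => r rs; rewrite bracket_comb//.
by rewrite mulfK// gt_eqF// A0.
Qed.

Lemma ortho_proj_combE f : exists x, ortho_proj f = iota (\sum_(q <- s) x q *: b q).
Proof.
by exists (fun r => bracket_ext iota f (b r) / A r); rewrite iota_sum// ortho_projE.
Qed.

Lemma ortho_proj_idem f : ortho_proj (ortho_proj f) = ortho_proj f.
Proof. by have [x ->] := ortho_proj_combE f; exact: ortho_proj_comb. Qed.

Lemma ortho_proj_orth f r : r \in s -> bracket_ext iota (f - ortho_proj f) (b r) = 0.
Proof.
move=> rs; have -> : f - ortho_proj f = -1 *: ortho_proj f + f by rewrite scaleN1r addrC.
rewrite (bracket_ext_lin (bs rs) (bbd rs)) ortho_projE -iota_sum//.
rewrite (bracket_ext_iota (bs rs) (bbd rs)); last exact: haar_span_sum.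
by rewrite bracket_comb// divfK ?gt_eqF ?A0// mulN1r addNr.
Qed.

Lemma lspan_comb (u : R * R -> R) : spanb u -> exists x, u = \sum_(q <- s) x q *: b q.
Proof.
move: u; apply: lspan_sub.
- move=> _ [r /= rs <-]; exists (fun q => (q == r)%:R).
  rewrite (bigD1_seq r)//= eqxx scale1r big1 ?addr0// => q /negbTE ->.
  by rewrite scale0r.
- by exists (fun=> 0); rewrite big1// => r _; rewrite scale0r.
- move=> x _ _ [y ->] [z ->]; exists (fun q => x * y q + z q).
  rewrite scaler_sumr -big_split; apply: eq_bigr => r _ /=.
  by rewrite scalerDl scalerA.
Qed.

Lemma ortho_proj_range : range ortho_proj = iota @` spanb.
Proof.
apply/seteqP; split=> [_ [f _ <-]|_ [u /lspan_comb[x ->] <-]].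
  have [x ->] := ortho_proj_combE f; eexists; last by [].
  by apply: lspan_seq => r rs; exists r.
by exists (iota (\sum_(q <- s) x q *: b q)) => //; exact: ortho_proj_comb.
Qed.

(** On the dense image of the Haar span this is the contraction hypothesis; a
    crude Lipschitz bound for the projection extends it to the completion. *)
Lemma ortho_proj_norm f : `|ortho_proj f| <= `|f|.
Proof.
pose K := \sum_(r <- s) `|(A r)^-1| * `|iota (b r)|.
have K0 : 0 <= K by apply: sumr_ge0 => r _; rewrite mulr_ge0.
have projK h : `|ortho_proj h| <= K * `|h|.
  rewrite ortho_projE; apply: (le_trans (ler_norm_sum _ _ _)); rewrite mulr_suml.
  rewrite big_seq [leRHS]big_seq; apply: ler_sum => r rs; rewrite normrZ normrM.
  have := bracket_ext_norm (bs rs) (bbd rs) h; rewrite mul1r => le.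
  rewrite [leRHS]mulrC mulrA; apply: ler_wpM2r => //; exact: ler_wpM2r.
apply: (@ler_addgt0_scale _ _ _ (K + 1)); first by rewrite addr_ge0.
move=> e e0; have [u us' ue] := iota_dense f e0.
have E : ortho_proj f = ortho_proj (f - iota u) + ortho_proj (iota u).
  have := ortho_proj_linear 1 (f - iota u) (iota u).
  by rewrite !scale1r subrK.
have h1 : `|ortho_proj (iota u)| <= `|iota u|.
  rewrite ortho_proj_iota// !iota_norm//; first exact: contr.
  exact: haar_span_sum.
have h2 : `|ortho_proj (f - iota u)| <= K * e.
  by apply: (le_trans (projK _)); rewrite ler_wpM2l// ltW.
have h3 : `|iota u| <= `|f| + e.
  have -> : iota u = f - (f - iota u) by rewrite opprB addrC subrK.
  by apply: (le_trans (ler_normB _ _)); rewrite lerD2l ltW.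
rewrite E; apply: (le_trans (ler_normD _ _)).
apply: (le_trans (lerD h2 (le_trans h1 h3))).
by rewrite mulrDl mul1r addrCA.
Qed.

End projection.
End completion.

(** * Block functions as sums of Haar functions *)

Section block_functions.
Variables (R : realType).

Lemma rects_le_set n : rects_le R n = [set` rseq n].
Proof. by apply/seteqP; split=> r /rects_leE. Qed.

Lemma fsum_rects_leD1 n (r : rect) (F : rect -> R) : r \in rseq n ->
  \sum_(q \in rects_le R n `\ r) F q = \sum_(q <- rseq n | q != r) F q.
Proof.
move=> rn; apply: (addrI (F r)).
have rD : rects_le R n r by apply/rects_leE.
have fin : finite_set (rects_le R n) by rewrite rects_le_set; exact: finite_seq.
by rewrite -(big_rseqD1 _ rn) -(fsum_rects_le R) (fsbigD1 r _ _ fin rD).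
Qed.

Lemma inblock_rseq W n N r m q : (0 < W)%N -> (n.+1 * W <= N)%N ->
  r \in rseq n -> admissible W r m -> inblock W r m q -> q \in rseq N.
Proof.
move=> W0 nN rn rm /and3P[/eqP q1 /eqP q2 _]; rewrite mem_rseq q1 q2.
rewrite (leq_trans (ltnW (admissible_lt rn rm)) nN)/=.
move: rn; rewrite mem_rseq => /andP[_ /leq_trans]; apply; exact: leq_nN W0 nN.
Qed.

(** The block does not depend on the range N in which it is expanded; this lets it be
    paired with functions of arbitrarily high frequency. *)
Lemma haar_block_blockfun W n N r m : (0 < W)%N -> (n.+1 * W <= N)%N ->
  r \in rseq n -> admissible W r m -> haar_block [set q | inblock W r m q] = @blockfun R W N r m.
Proof.
move=> W0 nN rn rm; rewrite /haar_block.
transitivity (\sum_(q \in [set q | inblock W r m q]) (inblock W r m q)%:R *: (haar q : R * R -> R)).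
  by apply: eq_fsbigr => q; rewrite inE /= => ->; rewrite scale1r.
apply: fsbig_fwiden; rewrite ?rseq_uniq//.
  by move=> q /=; exact: inblock_rseq W0 nN rn rm.
by move=> q [_ /= /negP/negbTE e]; rewrite /preimage /= e scale0r.
Qed.

Lemma dyadic_disjoint (I J : dyadic) (x : R) : tag I = tag J ->
  dleft I <= x < dright I -> dleft J <= x < dright J -> I = J.
Proof.
case: I J => [i u] [j v] /= ij; subst j.
have E (w : 'I_(2 ^ i)) : (dleft (existT _ i w) <= x < dright (existT _ i w)) =
    ((w%:R : R) <= x * 2 ^+ i < w.+1%:R).
  rewrite /dright /dleft /dlen /= -[w.+1%:R]natr1 -ler_pdivrMr ?exprn_gt0//.
  by rewrite -ltr_pdivlMr ?exprn_gt0// mulrDl mul1r.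
rewrite !E => /andP[u1 u2] /andP[v1 v2]; congr existT; apply/val_inj.
move: (le_lt_trans u1 v2) (le_lt_trans v1 u2); rewrite !ltr_nat !ltnS => uv vu.
by apply/eqP; rewrite eqn_leq uv.
Qed.

Lemma inblock_disjoint W r m q q' (p : R * R) : inblock W r m q -> inblock W r m q' ->
  rset R q p -> rset R q' p -> q = q'.
Proof.
case: q q' => [K L] [K' L'] /and3P[/= /eqP m1 /eqP -> _] /and3P[/= /eqP m2 /eqP -> _].
case=> /= + _ [/= + _]; rewrite !in_itv /= => p1 p2; congr pair.
by apply: dyadic_disjoint p1 p2; rewrite m1 m2.
Qed.

Lemma haar1_norm (I : dyadic) (x : R) : `|haar1 I x| <= (x \in `[dleft I, dright I[)%:R.
Proof.
have d0 := dlen_gt0 R I.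
have lm : dleft I < dmid I :> R by rewrite /dmid ltrDl divr_gt0.
have mr : dmid I < dright I :> R by rewrite /dmid /dright ltrD2l ltr_pdivrMr// ltr_pMr// ltr1n.
rewrite /haar1 !indicE !mem_setE !in_itv /=.
have [lx|xl] := leP (dleft I) x; have [mx|xm] := leP (dmid I) x;
  have [rx|xr] := leP (dright I) x; rewrite /= ?subr0 ?sub0r ?normrN ?normr1 ?normr0 ?ler01//.
- by move: (lt_le_trans mr rx) => /(lt_trans xm); rewrite ltxx.
- by move: (lt_le_trans xl (ltW (lt_le_trans lm mx))); rewrite ltxx.
Qed.

Lemma haar_norm q (p : R * R) : `|haar q p| <= (p \in rset R q)%:R.
Proof.
rewrite /haar normrM; apply: (le_trans (ler_pM _ _ (haar1_norm _ _) (haar1_norm _ _))) => //.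
rewrite -natrM mulnb ler_nat; case: andP => // -[h1 h2].
by rewrite mem_set.
Qed.

(** The rectangles of a block are disjoint and Haar functions are bounded by 1. *)
Lemma blockfun_norm_le1 W N r m (p : R * R) : `|(@blockfun R W N r m) p| <= 1.
Proof.
pose P q := inblock W r m q && (p \in rset R q).
have PP : {in rseq N &, forall q q', P q -> P q' -> q = q'}.
  move=> q q' _ _ /andP[b1 /set_mem p1] /andP[b2 /set_mem p2].
  exact: inblock_disjoint b1 b2 p1 p2.
rewrite /blockfun hsumE; apply: (le_trans (ler_norm_sum _ _ _)).
apply: le_trans (sum_disjoint_le1 R (rseq_uniq N) PP).
apply: ler_sum => q _; rewrite normrM normr_nat /P -mulnb natrM.
by rewrite ler_wpM2l// haar_norm.
Qed.

Lemma exists_small (s : seq rect) (e : rect -> R) : (forall r, r \in s -> 0 < e r) ->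
  exists2 d, 0 < d & forall r, r \in s -> d <= e r.
Proof.
elim: s => [|r s IH] e0; first by exists 1.
have [|d d0 de] := IH; first by move=> q qs; apply: e0; rewrite inE qs orbT.
exists (Num.min d (e r)); first by rewrite lt_min d0 e0// mem_head.
move=> q; rewrite inE => /predU1P[->|qs]; first by rewrite ge_min lexx orbT.
by rewrite ge_min de.
Qed.

(** With $W = w^2$ the claim reads $x \le w d$. *)
Lemma exists_width (x d : R) : 0 <= x -> 0 < d ->
  exists2 W : nat, (0 < W)%N & x * Num.sqrt W%:R <= W%:R * d.
Proof.
move=> x0 d0; set w := (Num.bound (x / d)).+1; exists (w ^ 2)%N; first by rewrite expn_gt0.
rewrite natrX sqrtr_sqr ger0_norm// mulrC expr2 -mulrA ler_wpM2l//.
rewrite -ler_pdivrMr//; apply/ltW; apply: (lt_le_trans (archi_boundP _)).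
  by rewrite divr_ge0// ltW.
by rewrite ler_nat.
Qed.

End block_functions.

(** * The isomorphism and the projection *)

Section quasidiagonal_system.
Variables (R : realType) (W n : nat) (freq : rect -> nat).
Hypotheses (W0 : (0 < W)%N) (freq_ok : forall r, r \in rseq n -> admissible W r (freq r)).

Definition bfun (r : rect) : R * R -> R := haar_block [set q | inblock W r (freq r) q].

Let spanb : set (R * R -> R) := lspan (bfun @` rects_le R n).

Lemma bfunE N r : (n.+1 * W <= N)%N -> r \in rseq n -> bfun r = @blockfun R W N r (freq r).
Proof. by move=> nN rn; apply: haar_block_blockfun W0 nN rn (freq_ok rn). Qed.

Lemma bfun_comb N (x : rect -> R) : (n.+1 * W <= N)%N ->
  \sum_(r <- rseq n) x r *: bfun r = \sum_(r <- rseq n) x r *: @blockfun R W N r (freq r).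
Proof. by move=> nN; apply: eq_big_seq => r rn; rewrite (bfunE nN rn). Qed.

Lemma bfun_span r : r \in rseq n -> haar_span (bfun r).
Proof. by move=> rn; rewrite (bfunE (leqnn _) rn); exact: hsum_span. Qed.

Lemma bracket_bfun r : r \in rseq n -> bracket (bfun r) (bfun r) = area R r.
Proof.
move=> rn; rewrite (bfunE (leqnn _) rn).
by rewrite (bracket_blockfun_diag R W0 (leqnn _) (ltnSn _) rn (freq_ok rn)).
Qed.

Lemma bracket_bfun_off :
  {in rseq n &, forall r r', r != r' -> bracket (bfun r) (bfun r') = 0}.
Proof.
move=> r r' rn rn' rr; rewrite (bfunE (leqnn _) rn) (bfunE (leqnn _) rn').
exact: bracket_blockfun_off (freq_ok rn) (freq_ok rn') rr.
Qed.

Lemma wide_span (u : R * R -> R) : haar_span u ->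
  exists N a, (n.+1 * W <= N)%N /\ u = hsum N a.
Proof.
move=> /haar_span_wide[N0 h]; have [a ua] := h _ (leq_maxl N0 (n.+1 * W)).
by exists (maxn N0 (n.+1 * W)), a; split=> //; exact: leq_maxr.
Qed.

Lemma bfun_bounded r : r \in rseq n -> bounded_on_span (bfun r) 1.
Proof.
move=> rn; split=> // u /wide_span[N [a [nN ->]]]; rewrite mul1r (bfunE nN rn).
by apply: (norm_bracket_blockfun W0 nN rn (freq_ok rn)); apply/H1nP; exists a.
Qed.

Lemma bfun_isometry (x : rect -> R) :
  H1norm (\sum_(r <- rseq n) x r *: bfun r) = H1norm (hsum n x).
Proof.
rewrite (bfun_comb _ (leqnn _)).
exact: (@H1norm_blocks R W n (n.+1 * W) (n.+1 * W).+1 W0 (leqnn _) (ltnSn _) freq freq_ok x).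
Qed.

Lemma bfun_contraction (u : R * R -> R) : haar_span u ->
  H1norm (\sum_(r <- rseq n) (bracket u (bfun r) / area R r) *: bfun r) <= H1norm u.
Proof.
move=> /wide_span[N [a [nN ->]]]; rewrite bfun_isometry.
have -> : hsum n (fun r => bracket (hsum N a) (bfun r) / area R r) = hsum n (blockcoef W N freq a).
  by apply: eq_big_seq => r rn; rewrite (bfunE nN rn).
exact: (H1norm_blockcoef W0 nN (ltnSn N) freq_ok a).
Qed.

Definition Sop (f : R * R -> R) : R * R -> R :=
  \sum_(r <- rseq n) (bracket f (haar r) / area R r) *: bfun r.

Definition Sinv (g : R * R -> R) : R * R -> R :=
  \sum_(r <- rseq n) (bracket g (bfun r) / area R r) *: haar r.

Lemma Sop_hsum (a : rect -> R) : Sop (hsum n a) = \sum_(r <- rseq n) a r *: bfun r.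
Proof.
apply: eq_big_seq => r rn; congr (_ *: _).
rewrite (haar_hsum _ rn) bracket_hsum (big_rseqD1 _ rn) eqxx mulr1 big1 ?addr0.
  by rewrite mulfK// gt_eqF// area_gt0.
by move=> q /negbTE ->; rewrite mulr0 mul0r.
Qed.

Lemma Sinv_comb (x : rect -> R) : Sinv (\sum_(r <- rseq n) x r *: bfun r) = hsum n x.
Proof.
apply: eq_big_seq => r rn; congr (_ *: _).
rewrite (bracket_comb (rseq_uniq n) bfun_span bracket_bfun bracket_bfun_off _ rn).
by rewrite mulfK// gt_eqF// area_gt0.
Qed.

Lemma spanbP (g : R * R -> R) : spanb g <-> exists x, g = \sum_(r <- rseq n) x r *: bfun r.
Proof.
rewrite /spanb rects_le_set; split; first exact: (lspan_comb (rseq_uniq n)).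
by move=> [x ->]; apply: lspan_seq => r rn; exists r.
Qed.

Lemma opnorm_le1 (V U : Type) (D : set V) (nV : V -> R) (nU : U -> R) (T : V -> U) :
  (forall f, D f -> nU (T f) <= nV f) -> (opnorm nV nU D T <= 1)%E.
Proof.
move=> TD; apply: ge_ereal_sup => _ [f [Df f1] <-].
by rewrite lee_fin; apply: le_trans f1; exact: TD.
Qed.

Lemma opnorm_ge0 (V : zmodType) (U : Type) (D : set V) (nV : V -> R) (nU : U -> R) (T : V -> U) :
  D 0 -> nV 0 <= 1 -> 0 <= nU (T 0) -> (0 <= opnorm nV nU D T)%E.
Proof.
move=> D0 n0 nU0; apply: (@le_trans _ _ (nU (T 0))%:E); first by rewrite lee_fin.
by apply: ereal_sup_ubound; exists 0.
Qed.

(** Sop and Sinv are inverse isometries. *)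
Lemma bfun_isomorphism N : (n.+1 * W <= N)%N ->
  [/\ linear_on (H1n n) Sop /\ (forall r, rects_le R n r -> Sop (haar r) = bfun r),
      (forall f, H1n n f -> (spanb `&` H1n N) (Sop f) /\ Sinv (Sop f) = f),
      (forall g, (spanb `&` H1n N) g -> H1n n (Sinv g) /\ Sop (Sinv g) = g),
      (opnorm H1norm H1norm (H1n n) Sop < +oo)%E /\
      (opnorm H1norm H1norm (spanb `&` H1n N) Sinv < +oo)%E &
      (opnorm H1norm H1norm (H1n n) Sop *
       opnorm H1norm H1norm (spanb `&` H1n N) Sinv <= 1%:E)%E].
Proof.
move=> nN.
have combN (x : rect -> R) : (spanb `&` H1n N) (\sum_(r <- rseq n) x r *: bfun r).
  split; first by apply/spanbP; exists x.
  by rewrite (bfun_comb _ nN); apply/H1nP; eexists; exact: hsum_sum.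
have S1 : (opnorm H1norm H1norm (H1n n) Sop <= 1)%E.
  by apply: opnorm_le1 => f /H1nP[a ->]; rewrite Sop_hsum bfun_isometry.
have S1' : (opnorm H1norm H1norm (spanb `&` H1n N) Sinv <= 1)%E.
  by apply: opnorm_le1 => g [/spanbP[x ->] _]; rewrite Sinv_comb bfun_isometry.
have H10 : H1norm (0 : R * R -> R) = 0.
  by have := H1normZ 0 0 (fun=> 0 : R); rewrite scale0r normr0 mul0r.
have S0 : (0 <= opnorm H1norm H1norm (H1n n) Sop)%E.
  apply: opnorm_ge0; rewrite ?H10//; first exact: H1n0.
  by rewrite -(hsum0 R n) Sop_hsum bfun_isometry; exact: H1norm_ge0.
have comb0 : \sum_(r <- rseq n) 0 *: bfun r = 0.
  by rewrite big1// => r _; rewrite scale0r.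
have S0' : (0 <= opnorm H1norm H1norm (spanb `&` H1n N) Sinv)%E.
  apply: opnorm_ge0; rewrite ?H10//; first by rewrite -comb0; exact: combN.
  by rewrite -comb0 Sinv_comb; exact: H1norm_ge0.
split.
- split=> [x f g /H1nP[a ->] /H1nP[c ->]|r /rects_leE rn].
    rewrite hsum_lin !Sop_hsum scaler_sumr -big_split; apply: eq_bigr => r _ /=.
    by rewrite scalerDl scalerA.
  rewrite (haar_hsum _ rn) Sop_hsum (big_rseqD1 _ rn) eqxx scale1r big1 ?addr0//.
  by move=> q /negbTE ->; rewrite scale0r.
- by move=> f /H1nP[a ->]; rewrite Sop_hsum Sinv_comb.
- move=> g [/spanbP[x ->] _]; rewrite Sinv_comb Sop_hsum; split=> //.
  by apply/H1nP; exists x.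
- by split; [apply: le_lt_trans S1 _ | apply: le_lt_trans S1' _]; rewrite ltry.
- by rewrite -[1%:E]mule1; apply: lee_pmul.
Qed.

Lemma bfun_projection (H : completeNormedModType R) (iota : (R * R -> R) -> H) :
  is_completion iota -> let Q : H -> H := Qproj iota n bfun in
  [/\ linear Q,
      (forall f, Q (Q f) = Q f),
      (forall f r, rects_le R n r -> bracket_ext iota (f - Q f) (bfun r) = 0),
      range Q = iota @` spanb &
      (opnorm (fun x : H => `|x|%R) (fun x : H => `|x|%R) setT Q <= 1%:E)%E].
Proof.
move=> Hc Q.
have -> : Q = ortho_proj iota (rseq n) bfun.
  by apply/funext => f; rewrite /Q /Qproj fsum_rects_le.
have A0 r : r \in rseq n -> 0 < area R r by move=> _; exact: area_gt0.
rewrite /spanb rects_le_set; split.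
- have L := ortho_proj_linear Hc (A := area R) A0 bfun_span bracket_bfun bfun_bounded.
  exact: L.
- exact: (ortho_proj_idem Hc (A := area R) (rseq_uniq n)
    A0 bfun_span bracket_bfun bracket_bfun_off bfun_bounded).
- move=> f r rn; apply: (ortho_proj_orth Hc (A := area R) (rseq_uniq n)
    A0 bfun_span bracket_bfun bracket_bfun_off bfun_bounded) => //.
- exact: (ortho_proj_range Hc (A := area R) (rseq_uniq n)
    A0 bfun_span bracket_bfun bracket_bfun_off bfun_bounded).
- apply: opnorm_le1 => f _.
  exact: (ortho_proj_norm Hc (A := area R)
    A0 bfun_span bracket_bfun bfun_bounded bfun_contraction f).
Qed.

End quasidiagonal_system.

(** * Quasi-diagonalization *)

Theorem theorem3p2 (R : realType) :
  exists C2 C3 : R, [/\ 0 < C2, 0 < C3 &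
  forall (n : nat) (M : R) (eps : rect -> R),
  (0 < n)%N -> 0 < M -> (forall r, rects_le R n r -> 0 < eps r) ->
  exists N : nat, (0 < N)%N /\
  forall T : (R * R -> R) -> (R * R -> R),
  linear_on (H1n N) T ->
  (forall f, H1n N f -> H1n N (T f)) ->
  (opnorm H1norm H1norm (H1n N) T <= M%:E)%E ->
  exists E : rect -> set rect,
  let b : rect -> R * R -> R := fun r => haar_block (E r) in
  let spanb : set (R * R -> R) := lspan (b @` rects_le R n) in
  [/\ trivIset (rects_le R n) E /\
      (forall r, rects_le R n r -> trivIset (E r) (rset R)),
      (* (i) *)
      forall r, rects_le R n r ->
        E r `<=` rects_le R N /\ (forall x, `|b r x| <= 1),
      (* (ii) *)
      forall (H : completeNormedModType R) (iota : (R * R -> R) -> H),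
        is_completion iota ->
        let Q : H -> H := Qproj iota n b in
        [/\ linear Q,
            (forall f, Q (Q f) = Q f),
            (forall f r, rects_le R n r -> bracket_ext iota (f - Q f) (b r) = 0),
            range Q = iota @` spanb &
            (opnorm (fun x : H => `|x|%R) (fun x : H => `|x|%R) setT Q <= C2%:E)%E],
      (* (iii) *)
      exists S S' : (R * R -> R) -> (R * R -> R),
        [/\ linear_on (H1n n) S /\
            (forall r, rects_le R n r -> S (haar r) = b r),
            (forall f, H1n n f -> (spanb `&` H1n N) (S f) /\ S' (S f) = f),
            (forall g, (spanb `&` H1n N) g -> H1n n (S' g) /\ S (S' g) = g),
            (opnorm H1norm H1norm (H1n n) S < +oo)%E /\
            (opnorm H1norm H1norm (spanb `&` H1n N) S' < +oo)%E &
            (opnorm H1norm H1norm (H1n n) S *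
             opnorm H1norm H1norm (spanb `&` H1n N) S' <= C3%:E)%E] &
      (* (iv) *)
      forall r, rects_le R n r ->
        \sum_(k \in rects_le R n `\ r) `|bracket (T (b k)) (b r)|
          <= eps r * norm2 (b r) ^+ 2]].
Proof.
exists 1, 1; split=> // n M eps _ M0 eps0.
(* P + 1 instead of P avoids a division by 0. *)
pose P : R := (size (rseq n))%:R.
have [d d0 dE] : exists2 d, 0 < d & forall r, r \in rseq n -> d <= eps r * area R r / (P + 1).
  apply: exists_small => r /rects_leE rn.
  apply: divr_gt0; last by rewrite ltr_wpDl ?ler0n.
  by apply: mulr_gt0; [exact: eps0 | exact: area_gt0].
have [||W W0 WE] := @exists_width R (2 * P * M) d; rewrite ?mulr_ge0 ?ltW//.
exists (n.+1 * W)%N; split; first by rewrite muln_gt0.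
move=> T Tlin TN TM.
have [||||freq [freq_ok freq_small]] := @select_freqs R W n _ W0 (leqnn _) T M M0 Tlin TN TM
  (size (rseq n)) d (rseq n).
- by rewrite mulrA.
- exact: leqnn.
- exact: rseq_uniq.
- by [].
exists (fun r => [set q | inblock W r (freq r) q]) => b spanb.
have bE r : r \in rseq n -> b r = @blockfun R W (n.+1 * W) r (freq r).
  exact: bfunE.
split.
- split=> [r r' /rects_leE rn /rects_leE rn' [q [b1 b2]]|r _ q q' b1 b2 [p [p1 p2]]].
    by have [] := inblock_inj (freq_ok r rn) (freq_ok r' rn') b1 b2.
  exact: inblock_disjoint b1 b2 p1 p2.
- move=> r /rects_leE rn; split=> [q bq|p].
    by apply/rects_leE; apply: inblock_rseq bq => //; exact: freq_ok.
  by rewrite bE//; exact: blockfun_norm_le1.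
- exact: bfun_projection.
- exists (@Sop R W n freq), (@Sinv R W n freq).
  exact: bfun_isomorphism.
- move=> r /rects_leE rn; rewrite norm2_sqr; last first.
    by rewrite (bracket_bfun R W0 freq_ok rn) ltW// area_gt0.
  rewrite [bracket (b r) (b r)](bracket_bfun R W0 freq_ok rn).
  apply: (@le_trans _ _ (\sum_(k <- rseq n) d)).
    rewrite fsum_rects_leD1//; apply: (@le_trans _ _ (\sum_(k <- rseq n | k != r) d)).
      rewrite big_seq_cond [leRHS]big_seq_cond; apply: ler_sum => k /andP[kn kr].
      by rewrite !bE//; exact: freq_small.
    by rewrite (big_rseqD1 _ rn) lerDr ltW.
  rewrite big_const_seq count_predT iter_addr_0 -mulr_natl -/P.
  have P0 : 0 < P + 1 by rewrite ltr_wpDl ?ler0n.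
  apply: (@le_trans _ _ ((P + 1) * d)); first by rewrite ler_wpM2r ?lerDl// ltW.
  by rewrite -ler_pdivlMl// mulrC; exact: dE.
Qed.
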